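(* Let $F:\mathbb{C}\to\mathbb{C}$ be a bounded (Lebesgue measurable) function. If the Toeplitz operator $\mathbf{T}(F):\mathcal{B}\to\mathcal{B}$, $\mathbf{T}(F)u=\mathbf{P}(Fu)$, on the Fock space $\mathcal{B}$ has finite rank, then $F=0$ almost everywhere with respect to Lebesgue measure on $\mathbb{C}$.
   Context: Let $\lambda$ be Lebesgue measure on $\mathbb{C}\cong\mathbb{R}^2$ and let $\nu$ be the Gaussian measure $d\nu=\pi^{-1}e^{-|z|^2}d\lambda(z)$. The Fock space $\mathcal{B}$ is the closed subspace of $L^2(\mathbb{C},d\nu)$ consisting of entire functions, and $\mathbf{P}:L^2(\mathbb{C},d\nu)\to\mathcal{B}$ is the orthogonal projection. For bounded measurable $F$, the Toeplitz operator $\mathbf{T}(F)u=\mathbf{P}(Fu)$ is an everywhere defined bounded operator on $\mathcal{B}$; explicitly, $(\mathbf{T}(F)u)(z)=\int_{\mathbb{C}}e^{z\overline{w}}F(w)u(w)\,d\nu(w)$. The operator has finite rank if there are $N\ge 0$ and $f_1,\dots,f_N,g_1,\dots,g_N\in\mathcal{B}$ such that $\mathbf{T}(F)u=\sum_{j=1}^N(u,g_j)f_j$ for all $u\in\mathcal{B}$, where $(\cdot,\cdot)$ is the scalar product of $L^2(\mathbb{C},d\nu)$. *)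

(* Defs.v *)
From HB Require Import structures.
From mathcomp Require Import all_boot all_order all_algebra.
From mathcomp Require Import complex.
From mathcomp Require Import all_classical all_reals all_analysis.
From mathcomp Require Import measurable_realfun.

Set Implicit Arguments.
Unset Strict Implicit.
Unset Printing Implicit Defensive.

Import Order.TTheory GRing.Theory Num.Theory.
Import numFieldNormedType.Exports.

Local Open Scope classical_set_scope.
Local Open Scope ring_scope.
Local Open Scope complex_scope.

Section lebesgue_plane.
Context {R : realType}.

Definition borel_lebesgue2 :
    {measure set (measurableTypeR R * measurableTypeR R) -> \bar R} :=
  (@lebesgue_measure R \x @lebesgue_measure R)%E.

(* R^2 with the sigma-algebra of all Lebesgue measurable sets: the product of
   two Borel-Lebesgue measures is not complete, so we take the Caratheodory
   sigma-algebra of the outer measure it induces. *)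
Definition plane : measurableType _ := caratheodory_type (borel_lebesgue2^*)%mu.

Definition lambda : {measure set plane -> \bar R} :=
  @completed_measure_extension _ _ _ borel_lebesgue2.

Definition complex_of_plane (p : plane) : R[i] := p.1 +i* p.2.

Definition pair_of_complex (z : R[i]) : measurableTypeR R * measurableTypeR R :=
  (complex.Re z, complex.Im z).

(* preimages of Borel sets are Lebesgue measurable *)
Definition cmeasurable (f : R[i] -> R[i]) :=
  measurable_fun [set: plane] (pair_of_complex \o f \o complex_of_plane).

End lebesgue_plane.
Arguments plane : clear implicits.

Section gaussian_measure.
Context {R : realType}.

Definition gauss_density (p : plane R) : R :=
  pi^-1 * expR (- Normc.normc (complex_of_plane p) ^+ 2).

Definition nu (A : set (plane R)) : \bar R :=
  (\int[lambda]_(p in A) (gauss_density p)%:E)%E.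

Lemma gauss_density_ge0 p : 0 <= gauss_density p.
Proof. by rewrite mulr_ge0 ?expR_ge0// invr_ge0 pi_ge0. Qed.

Lemma measurable_plane (A : set (measurableTypeR R * measurableTypeR R)) :
  measurable A -> measurable (A : set (plane R)).
Proof. by move=> mA; apply: sub_caratheodory; exact: sub_sigma_algebra. Qed.

Lemma measurable_gauss_density : measurable_fun setT gauss_density.
Proof.
pose g (p : measurableTypeR R * measurableTypeR R) : R :=
  pi^-1 * expR (- (p.1 ^+ 2 + p.2 ^+ 2)).
have mg : measurable_fun setT g.
  apply: measurable_funM => //; apply: measurableT_comp => //.
  apply: measurableT_comp => //.
  by apply: measurable_funD; apply: measurable_funX.
have -> : gauss_density = g.
  apply/funext => p; rewrite /gauss_density /g /= sqr_sqrtr//.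
  by rewrite addr_ge0 ?sqr_ge0.
move=> _ B mB; rewrite setTI; apply: measurable_plane.
by rewrite -[X in measurable X]setTI; exact: mg.
Qed.

Let nu0 : nu set0 = 0%E.
Proof. exact: integral_set0. Qed.

Let nu_ge0 A : (0 <= nu A)%E.
Proof. by apply: integral_ge0 => p _; rewrite lee_fin gauss_density_ge0. Qed.

Let nu_sigma_additive : semi_sigma_additive nu.
Proof.
move=> /= A mA tA mUA; rewrite /nu ge0_integral_bigcup//=.
- apply: is_cvg_ereal_nneg_natsum_cond => n _ _; exact: nu_ge0.
- apply: measurable_funTS; apply/measurable_EFinP.
  exact: measurable_gauss_density.
- by move=> p _; rewrite lee_fin gauss_density_ge0.
Qed.

HB.instance Definition _ := isMeasure.Build _ _ _ nu
  nu0 nu_ge0 nu_sigma_additive.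

End gaussian_measure.

Section fock_space.
Context {R : realType}.
Implicit Types (u v : R[i] -> R[i]).

Definition cintegral (f : R[i] -> R[i]) : R[i] :=
  (\int[nu]_p complex.Re (f (complex_of_plane p))) +i*
  (\int[nu]_p complex.Im (f (complex_of_plane p))).

Definition L2 : set (R[i] -> R[i]) := [set u | cmeasurable u /\
  (\int[nu]_p ((Normc.normc (u (complex_of_plane p)) ^+ 2)%:E) < +oo)%E].

Definition inner u v : R[i] := cintegral (fun z => u z * (v z)^*).

Definition entire u := forall z : R[i], derivable (u : R[i]^o -> R[i]^o) z 1.

(* The elements of L^2 that are classes of an entire function are represented
   by that (unique) entire function. *)
Definition fock : set (R[i] -> R[i]) := [set u | L2 u /\ entire u].

(* The orthogonal projection of v on the closed subspace [fock] is the unique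
   p in [fock] with v - p orthogonal to [fock]; it exists for all v in L^2, and
   the default value of [xget] only matters for v outside of L^2. *)
Definition fock_proj v : R[i] -> R[i] :=
  xget v [set p | fock p /\ forall g, fock g -> inner (v \- p) g = 0].

Definition toeplitz (F : R[i] -> R[i]) u : R[i] -> R[i] :=
  fock_proj (F \* u).

Definition finite_rank (T : (R[i] -> R[i]) -> (R[i] -> R[i])) :=
  exists (N : nat) (f g : 'I_N -> (R[i] -> R[i])),
    [/\ forall j, fock (f j), forall j, fock (g j) &
        forall u, fock u ->
          T u = fun z => \sum_(j < N) inner u (g j) * f j z].

End fock_space.

(* Main.v *)
From HB Require Import structures.
Require Import Defs.
From mathcomp Require Import all_boot all_order all_algebra.
From mathcomp Require Import perm complex ring lra.
From mathcomp Require Import all_classical all_reals all_analysis.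
From mathcomp Require Import measurable_realfun.

Set Implicit Arguments.
Unset Strict Implicit.
Unset Printing Implicit Defensive.

Import Order.TTheory GRing.Theory Num.Theory.
Import numFieldNormedType.Exports.

Local Open Scope classical_set_scope.
Local Open Scope ring_scope.
Local Open Scope complex_scope.

(**
Put K(z, w) = (F e_{-w}, e_z) where e_z(v) = exp(v z^* ), that is, K(z, w) is the
integral of exp(z v^* - v w^* ) F(v) against the Gaussian measure. If T(F) has
finite rank, then K(z, w) is a finite sum of products
A_j(z) B_j(w). Let r be the largest size of a nonzero minor det K(a_i, b_j). By
maximality,
  det K(x + a_i, x + b_j) det K(a_i, b_j) = det K(x + a_i, b_j) det K(a_i, x + b_j).
On the left, |exp((x + a) v^* - v (x + b)^* )| does not depend on x: each entry is
a Fourier coefficient of frequency proportional to x of an integrable function,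
so for r > 0 the left side tends to 0 at infinity by the Riemann-Lebesgue lemma.
On the right, the first factor and the conjugate of the second one are entire in
x, so their product vanishes identically by Liouville's theorem, although it is
nonzero at x = 0. Hence r = 0, K = 0, and F = 0 almost everywhere by uniqueness of
the Fourier transform.

The Riemann-Lebesgue lemma and the uniqueness of the Fourier transform both follow
from the density of trigonometric polynomials in L^1. "Entire" is used in the form
"uniform limit of polynomials on every disc": averaging such a function over the
n-th roots of unity scaled to a large circle gives its value at 0 up to a small
error, which is Liouville's theorem.
*)

(** * Trigonometric polynomials in L^1 *)

(** The kernel is holomorphic in z and antiholomorphic in w. On the diagonal points (x + a, x + b),
    where decay is available, it is therefore not holomorphic in x, and Liouville's theorem cannot
    be applied there directly. The identity between minors separates the two occurrences of x, and
    conjugating one factor then leaves only holomorphic dependence. The sign in e_{-w} is chosen for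
    the decay: it makes the part of the exponent that is quadratic in (x, v) purely imaginary,
    whereas e_w would give it a real part growing with x. Finite rank enters through linear algebra
    alone; all analytic regularity comes from the integral defining K and from Gaussian
    integrability of exp(c |v|). Density in L^1 has to cover the completed sigma-algebra, so
    indicators of Borel sets are followed by an outer approximation of Lebesgue sets. For the
    Fourier transform of the Gaussian measure the rate O(1/|frequency|) suffices: multiplying by a
    trigonometric polynomial only shifts frequencies by bounded amounts, and density does the
    rest. *)

Section sign_iteration.
Context {R : realType}.
Implicit Types s : R.

(* A polynomial preserving [-1, 1] whose iterates converge pointwise to the sign:
   it yields indicators of half-planes as bounded limits of trigonometric
   polynomials. *)
Definition sgstep s : R := (3 * s - s ^+ 3) / 2.

(** The extreme values are attained with double roots: 1 + [sgstep s] = (s + 1)^2 (2 - s) / 2 and 1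
    - [sgstep s] = (1 - s)^2 (2 + s) / 2. *)
Lemma sgstep_norm s : `|s| <= 1 -> `|sgstep s| <= 1.
Proof.
rewrite !ler_norml => /andP[s1 s2]; apply/andP; split; rewrite /sgstep.
  suff : 0 <= (s + 1) ^+ 2 * (2 - s) by nra.
  by rewrite mulr_ge0 ?sqr_ge0//; lra.
suff : 0 <= (1 - s) ^+ 2 * (2 + s) by nra.
by rewrite mulr_ge0 ?sqr_ge0//; lra.
Qed.

Lemma iter_sgstep_norm n s : `|s| <= 1 -> `|iter n sgstep s| <= 1.
Proof. by move=> s1; elim: n => //= n IH; exact: sgstep_norm. Qed.

Lemma iter_sgstepN n s : iter n sgstep (- s) = - iter n sgstep s.
Proof. by elim: n => //= n ->; rewrite /sgstep; field. Qed.

Lemma iter_sgstep0 n : iter n sgstep (0 : R) = 0.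
Proof. by elim: n => //= n ->; rewrite /sgstep; field. Qed.

(** One step multiplies the distance 1 - t by 1 - (t + t^2) / 2. The iterates never fall below s, so
    this factor is at most 1 - s / 2 throughout, whence the geometric rate. *)
Lemma iter_sgstep_pos n s : 0 < s -> s <= 1 ->
  [/\ s <= iter n sgstep s, iter n sgstep s <= 1 &
   1 - iter n sgstep s <= (1 - s / 2) ^+ n].
Proof.
move=> s0 s1; elim: n => [|n [IH1 IH2 IH3]] /=.
  by split => //; rewrite expr0; lra.
set t := iter n sgstep s in IH1 IH2 IH3 *.
have E : 1 - sgstep t = (1 - t) * (1 - (t + t ^+ 2) / 2) by rewrite /sgstep; field.
have t0 : 0 <= t by lra.
have t2 : t ^+ 2 <= 1 by rewrite expr2; nra.
have t20 : 0 <= t ^+ 2 by exact: sqr_ge0.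
split.
- apply: le_trans IH1 _; rewrite -subr_ge0.
  have -> : sgstep t - t = t * (1 - t ^+ 2) / 2 by rewrite /sgstep; field.
  by rewrite divr_ge0// mulr_ge0//; lra.
- by rewrite -subr_ge0 E mulr_ge0//; lra.
- by rewrite E [leRHS]exprSr ler_pM//; lra.
Qed.

Lemma cvg_iter_sgstep s : `|s| <= 1 -> iter n sgstep s @[n --> \oo] --> Num.sg s.
Proof.
have pos t : 0 < t -> t <= 1 -> iter n sgstep t @[n --> \oo] --> (1 : R).
  move=> t0 t1.
  have q1 : `|1 - t / 2| < 1 by rewrite ltr_norml; apply/andP; split; lra.
  apply: (squeeze_cvgr (f := fun n => 1 - (1 - t / 2) ^+ n) (h := cst 1)).
  - apply: nearW => n; have [_ h1 h2] := iter_sgstep_pos n t0 t1.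
    by apply/andP; split => //; lra.
  - rewrite -[X in _ --> X]subr0; apply: cvgB; first exact: cvg_cst.
    exact: cvg_expr.
  - exact: cvg_cst.
have [s0|s0|->] := ltgtP s 0.
- rewrite (ltr0_norm s0) => s1; rewrite (ltr0_sg s0).
  have -> : (fun n => iter n sgstep s) = (fun n => - iter n sgstep (- s)).
    by apply/funext => n; rewrite iter_sgstepN opprK.
  by apply: cvgN; apply: pos; rewrite ?oppr_gt0.
- by rewrite (gtr0_norm s0) (gtr0_sg s0) => /(pos _ s0).
- by move=> _; rewrite sgr0; under eq_fun do rewrite iter_sgstep0; exact: cvg_cst.
Qed.

End sign_iteration.

(** * The L^1 closure of the trigonometric polynomials contains the Borel indicators *)

Section trig_closure.
Context {R : realType} {d : measure_display} {P : measurableType d}.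
Variables (mu : {finite_measure set P -> \bar R}) (X Y : P -> R).
Hypotheses (mX : measurable_fun setT X) (mY : measurable_fun setT Y).
Local Notation RR := (measurableTypeR R * measurableTypeR R)%type.
Implicit Types f g h : P -> R.

Lemma fin_bounded_integrable f (M : R) : measurable_fun setT f ->
  (forall p, `|f p| <= M) -> mu.-integrable setT (EFin \o f).
Proof.
move=> mf fM; apply: measurable_bounded_integrable => //.
  exact: fin_num_fun_lty (fin_num_measure mu).
by exists M; split; [exact: num_real|move=> x Mx p _; apply: le_trans (fM p) (ltW Mx)].
Qed.

(** The phase [c] brings in the sines and, at frequency zero, the constants, so that one real family
    of generators is enough and products reduce to [cosM_half]. *)
Inductive trig : (P -> R) -> Prop :=
| trig_cos k a b c : trig (fun p => k * cos (a * X p + b * Y p + c))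
| trig_add f g : trig f -> trig g -> trig (fun p => f p + g p).

Lemma measurable_trig f : trig f -> measurable_fun setT f.
Proof.
elim => [k a b c|{}f g _ mf _ mg]; last exact: measurable_funD.
apply: measurable_funM => //; apply: measurableT_comp.
  by apply: continuous_measurable_fun; exact: continuous_cos.
by apply: measurable_funD => //; apply: measurable_funD; apply: measurable_funM.
Qed.

Lemma trig_bounded f : trig f -> exists M, forall p, `|f p| <= M.
Proof.
elim => [k a b c|{}f g _ [M fM] _ [N gN]].
  exists `|k| => p; rewrite normrM ler_piMr// ler_norml cos_geN1 cos_le1//.
by exists (M + N) => p; rewrite (le_trans (ler_normD _ _))// lerD.
Qed.

Lemma cosM_half (k l x y : R) :
  k * cos x * (l * cos y) = k * l / 2 * cos (x + y) + k * l / 2 * cos (x - y).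
Proof. by rewrite cosD cosB; field. Qed.

Lemma trigM f g : trig f -> trig g -> trig (fun p => f p * g p).
Proof.
move=> tf; elim: tf g => [k a b c g|{}f f2 _ IH1 _ IH2 g tg]; last first.
  have -> : (fun p => (f p + f2 p) * g p) = (fun p => f p * g p + f2 p * g p).
    by apply/funext => p; rewrite mulrDl.
  by apply: trig_add; [exact: IH1|exact: IH2].
elim => [l a' b' c'|{}g g2 _ IH1 _ IH2]; last first.
  under eq_fun do rewrite mulrDr.
  exact: trig_add.
have -> : (fun p : P =>
    k * cos (a * X p + b * Y p + c) * (l * cos (a' * X p + b' * Y p + c'))) =
  (fun p : P => k * l / 2 * cos ((a + a') * X p + (b + b') * Y p + (c + c')) +
            k * l / 2 * cos ((a - a') * X p + (b - b') * Y p + (c - c'))).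
  apply/funext => p.
  by rewrite cosM_half; congr (_ * cos _ + _ * cos _); ring.
by apply: trig_add; exact: trig_cos.
Qed.

Definition L1dist f g : \bar R := (\int[mu]_p (`|f p - g p|)%:E)%E.

Let mdist (u v : P -> R) : measurable_fun setT u -> measurable_fun setT v ->
  measurable_fun setT (fun p => (`|u p - v p|)%:E).
Proof.
move=> mu1 mv; apply/measurable_EFinP; apply: measurableT_comp => //.
exact: measurable_funB.
Qed.

Lemma L1dist_tri f g h : measurable_fun setT f -> measurable_fun setT g ->
  measurable_fun setT h -> (L1dist f h <= L1dist f g + L1dist g h)%E.
Proof.
move=> mf mg mh.
rewrite /L1dist -ge0_integralD//; try exact: mdist.
apply: ge0_le_integral => //; first exact: mdist.
  by apply: emeasurable_funD; exact: mdist.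
move=> p _; rewrite -EFinD lee_fin.
by rewrite (le_trans _ (ler_normD _ _))// subrKA.
Qed.

Lemma L1distD f g f' g' : measurable_fun setT f -> measurable_fun setT g ->
  measurable_fun setT f' -> measurable_fun setT g' ->
  (L1dist (fun p => (f p + f' p)%R) (fun p => (g p + g' p)%R) <= L1dist f g + L1dist f' g')%E.
Proof.
move=> mf mg mf' mg'.
rewrite /L1dist -ge0_integralD//; try exact: mdist.
apply: ge0_le_integral => //.
- by apply: mdist; exact: measurable_funD.
- by apply: emeasurable_funD; exact: mdist.
move=> p _; rewrite -EFinD lee_fin.
by rewrite (le_trans _ (ler_normD _ _))// opprD addrACA.
Qed.

Lemma L1distM h f g M : (forall p, `|h p| <= M) -> measurable_fun setT h ->
  measurable_fun setT f -> measurable_fun setT g ->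
  (L1dist (fun p => (h p * f p)%R) (fun p => (h p * g p)%R) <= M%:E * L1dist f g)%E.
Proof.
move=> hM mh mf mg.
have M0 : 0 <= M by apply: le_trans (hM point).
rewrite /L1dist -ge0_integralZl//; try exact: mdist.
apply: ge0_le_integral => //.
- by apply: mdist; exact: measurable_funM.
- by apply: measurable_funeM; exact: mdist.
- by move=> p _; rewrite -EFinM lee_fin -mulrBr normrM ler_wpM2r.
Qed.

Definition trigcl f := measurable_fun setT f /\
  forall e : R, 0 < e -> exists2 h, trig h & (L1dist f h <= e%:E)%E.

Lemma trigcl_lim f : measurable_fun setT f ->
  (forall e : R, 0 < e -> exists2 g, trigcl g & (L1dist f g <= e%:E)%E) -> trigcl f.
Proof.
move=> mf H; split => // e e0.
have e20 : 0 < e / 2 by rewrite divr_gt0.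
have [g [mg gcl] fg] := H _ e20.
have [h th gh] := gcl _ e20; exists h => //.
apply: (le_trans (L1dist_tri mf mg (measurable_trig th))).
by rewrite [e]splitr EFinD leeD.
Qed.

Lemma trigcl_trig f : trig f -> trigcl f.
Proof.
move=> tf; split; first exact: measurable_trig.
move=> e e0; exists f => //; rewrite /L1dist.
under eq_integral do rewrite subrr normr0.
by rewrite integral0 lee_fin ltW.
Qed.

Lemma trigclD f g : trigcl f -> trigcl g -> trigcl (fun p => f p + g p).
Proof.
move=> [mf fcl] [mg gcl]; split; first exact: measurable_funD.
move=> e e0; have e20 : 0 < e / 2 by rewrite divr_gt0.
have [h th fh] := fcl _ e20; have [k tk gk] := gcl _ e20.
exists (fun p => h p + k p); first exact: trig_add.
apply: (le_trans (L1distD mf (measurable_trig th) mg (measurable_trig tk))).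
by rewrite [e]splitr EFinD leeD.
Qed.

Lemma trigcl_trigM h f : trig h -> trigcl f -> trigcl (fun p => h p * f p).
Proof.
move=> th [mf fcl]; have mh := measurable_trig th.
have [M hM] := trig_bounded th.
split; first exact: measurable_funM.
move=> e e0; have M0 : 0 <= M by apply: le_trans (hM point).
have eM0 : 0 < e / (M + 1) by rewrite divr_gt0//; lra.
have [k tk fk] := fcl _ eM0; exists (fun p => h p * k p); first exact: trigM.
apply: (le_trans (L1distM hM mh mf (measurable_trig tk))).
apply: (@le_trans _ _ (M%:E * (e / (M + 1))%:E)%E).
  by rewrite lee_wpmul2l ?lee_fin.
by rewrite -EFinM lee_fin mulrCA ler_piMr ?(ltW e0)// ler_pdivrMr//; lra.
Qed.

Lemma trig_cst k : trig (cst k).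
Proof.
have -> : cst k = (fun p : P => k * cos (0 * X p + 0 * Y p + 0)).
  by apply/funext => p; rewrite !mul0r !addr0 cos0 mulr1.
exact: trig_cos.
Qed.

(** The L^1 closure alone is not stable under products; its bounded elements form an algebra that is
    also closed under bounded pointwise limits. *)
Definition btrigcl f := trigcl f /\ exists M, forall p, `|f p| <= M.

Lemma btrigcl_trig f : trig f -> btrigcl f.
Proof. by move=> tf; split; [exact: trigcl_trig|exact: trig_bounded]. Qed.

Lemma btrigclD f g : btrigcl f -> btrigcl g -> btrigcl (fun p => f p + g p).
Proof.
move=> [fcl [M fM]] [gcl [N gN]]; split; first exact: trigclD.
by exists (M + N) => p; rewrite (le_trans (ler_normD _ _))// lerD.
Qed.

(** The factors are approximated one after the other. The approximant h of f need not share the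
    bound of f, but h is fixed and bounded when [trigcl_trigM] then approximates g with an accuracy
    depending on h. *)
Lemma btrigclM f g : btrigcl f -> btrigcl g -> btrigcl (fun p => f p * g p).
Proof.
move=> [fcl [M fM]] [gcl [N gN]]; split; last first.
  by exists (M * N) => p; rewrite normrM ler_pM.
have [[mf fap] [mg _]] := (fcl, gcl).
apply: trigcl_lim; first exact: measurable_funM.
move=> e e0; have N0 : 0 <= N by apply: le_trans (gN point).
have eN0 : 0 < e / (N + 1) by rewrite divr_gt0//; lra.
have [h th fh] := fap _ eN0; exists (fun p => h p * g p); first exact: trigcl_trigM.
have -> : (fun p => f p * g p) = (fun p => g p * f p) by apply/funext => p; rewrite mulrC.
have -> : (fun p => h p * g p) = (fun p => g p * h p) by apply/funext => p; rewrite mulrC.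
apply: (le_trans (L1distM gN mg mf (measurable_trig th))).
apply: (@le_trans _ _ (N%:E * (e / (N + 1))%:E)%E).
  by rewrite lee_wpmul2l ?lee_fin.
by rewrite -EFinM lee_fin mulrCA ler_piMr ?(ltW e0)// ler_pdivrMr//; lra.
Qed.

Lemma btrigclZ k f : btrigcl f -> btrigcl (fun p => k * f p).
Proof. by move=> fcl; apply: (@btrigclM (cst k)) => //; exact/btrigcl_trig/trig_cst. Qed.

(** Dominated convergence: constants are integrable because the measure is finite, so pointwise
    limits under a uniform bound are L^1 limits. *)
Lemma btrigcl_cvg (F : nat -> P -> R) f M : (forall n, btrigcl (F n)) ->
  (forall n p, `|F n p| <= M) -> (forall p, F n p @[n --> \oo] --> f p) -> btrigcl f.
Proof.
move=> Fcl FM Ff.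
have mF n : measurable_fun setT (F n) by have [[]] := Fcl n.
have mf : measurable_fun setT f.
  by apply: (measurable_fun_cvg mF) => p _; exact: Ff.
split; last first.
  exists M => p; apply: (cvgr_to_le (cvg_norm (Ff p))).
  by apply: nearW => n; exact: FM.
apply: trigcl_lim => // e e0.
have iM : mu.-integrable [set: P] (EFin \o (cst M)).
  by apply: (fin_bounded_integrable (M := `|M|)).
have Ff' : {ae mu, forall p : P, setT p -> (EFin \o F n) p @[n --> \oo] --> (EFin \o f) p}.
  by apply: aeW => p _; apply: cvg_EFin; [exact: nearW|exact: Ff].
have FM' : {ae mu, forall (p : P) n, setT p -> (`|(EFin \o F n) p| <= (EFin \o cst M) p)%E}.
  by apply: aeW => p n _; rewrite /= lee_fin.
have [_ + _] := dominated_convergence measurableT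
  (fun n => (measurable_EFinP _ _).2 (mF n)) ((measurable_EFinP _ _).2 mf) Ff' iM FM'.
move=> /fine_cvgP[fin_ /cvgr_le]/(_ _ e0) le_e.
near \oo => n; exists (F n); first by have [] := Fcl n.
rewrite /L1dist.
have -> : (\int[mu]_p (`|f p - F n p|)%:E = \int[mu]_p `|(EFin \o F n) p - (EFin \o f) p|)%E.
  by apply: eq_integral => p _; rewrite /= distrC.
rewrite -[X in (X <= _)%E]fineK; last by near: n.
by rewrite lee_fin; near: n.
Unshelve. all: by end_near. Qed.

Lemma btrigcl_sin a b c : btrigcl (fun p : P => sin (a * X p + b * Y p + c)).
Proof.
have -> : (fun p : P => sin (a * X p + b * Y p + c)) =
  (fun p : P => 1 * cos (a * X p + b * Y p + (c - pi / 2))).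
  by apply/funext => p; rewrite mul1r addrA cosBpihalf.
exact/btrigcl_trig/trig_cos.
Qed.

Lemma btrigcl_sg_bounded f : btrigcl f -> (forall p, `|f p| <= 1) ->
  btrigcl (fun p => Num.sg (f p)).
Proof.
move=> fcl f1; apply: (btrigcl_cvg (F := fun n p => iter n sgstep (f p)) (M := 1)).
- elim => [//|n IH] /=.
  have -> : (fun p => sgstep (iter n sgstep (f p))) =
    (fun p => 3 / 2 * iter n sgstep (f p) +
      - 2^-1 * (iter n sgstep (f p) * (iter n sgstep (f p) * iter n sgstep (f p)))).
    by apply/funext => p; rewrite /sgstep; field.
  apply: btrigclD; first exact: btrigclZ.
  by apply: btrigclZ; apply: btrigclM => //; exact: btrigclM.
- by move=> n p; exact: iter_sgstep_norm.
- by move=> p; exact: cvg_iter_sgstep.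
Qed.

Lemma sg_sin_small (x : R) : `|x| < pi -> Num.sg (sin x) = Num.sg x.
Proof.
have pos y : 0 < y -> y < pi -> Num.sg (sin y) = 1.
  by move=> y0 ypi; rewrite gtr0_sg// sin_gt0_pi// y0.
have [x0|x0|->] := ltgtP x 0.
- rewrite (ltr0_norm x0) (ltr0_sg x0) => xpi.
  by rewrite -[x]opprK sinN sgrN pos// oppr_gt0.
- by rewrite (gtr0_norm x0) (gtr0_sg x0); exact: pos.
- by rewrite sin0.
Qed.

(** The affine form is unbounded, so the sign iteration is applied to the sine of the form divided
    by n + 1. As soon as the quotient lies in (-pi, pi), this sine has the sign of the form
    itself. *)
Lemma btrigcl_sg a b c : btrigcl (fun p : P => Num.sg (a * X p + b * Y p + c)).
Proof.
apply: (btrigcl_cvg (F := fun n (p : P) => Num.sg (sin (a / n.+1%:R * X p +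
  b / n.+1%:R * Y p + c / n.+1%:R))) (M := 1)).
- move=> n; apply: btrigcl_sg_bounded; first exact: btrigcl_sin.
  by move=> p; rewrite ler_norml sin_geN1 sin_le1.
- by move=> n p; rewrite normr_sg; case: eqP.
- move=> p; apply: cvg_near_cst.
  near=> n.
  have E : a / n.+1%:R * X p + b / n.+1%:R * Y p + c / n.+1%:R =
    (a * X p + b * Y p + c) / n.+1%:R by field.
  rewrite E sg_sin_small; last first.
    rewrite normrM normfV (gtr0_norm (x := n.+1%:R))// ltr_pdivrMr//.
    rewrite -ltr_pdivrMl ?pi_gt0//; apply: (@lt_trans _ _ n%:R); last by rewrite ltr_nat.
    by near: n; exact: nbhs_infty_gtr.
  by rewrite sgrM sgrV (@gtr0_sg _ n.+1%:R)// mulr1.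
Unshelve. all: by end_near. Qed.

Lemma btrigcl_indic_halfplane a b c :
  btrigcl (\1_[set p : P | 0 < a * X p + b * Y p + c]).
Proof.
have -> : \1_[set p : P | 0 < a * X p + b * Y p + c] = (fun p : P =>
    2^-1 * (Num.sg (a * X p + b * Y p + c) +
      Num.sg (a * X p + b * Y p + c) * Num.sg (a * X p + b * Y p + c))).
  apply/funext => p; rewrite indicE.
  have [x0|x0|x0] := ltgtP 0 (a * X p + b * Y p + c).
  - by rewrite mem_set// gtr0_sg//= mulr1; field.
  - by rewrite memNset/=; [rewrite ltr0_sg//= mulrNN mulr1; ring|rewrite ltNge (ltW x0)].
  - by rewrite memNset/= -x0 ?ltxx// sgr0 mulr0 addr0 mulr0.
apply: btrigclZ; apply: btrigclD; first exact: btrigcl_sg.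
by apply: btrigclM; exact: btrigcl_sg.
Qed.

(** Products give intersections and bounded limits give countable unions, so the class is a
    sigma-algebra outright and can be compared with generators. *)
Lemma sigma_algebra_btrigcl :
  sigma_algebra [set: P] [set A : set P | btrigcl (\1_A)].
Proof.
have indic_le1 (A : set P) p : `|\1_A p : R| <= 1.
  by rewrite indicE; case: (_ \in _); rewrite ?normr1 ?normr0.
have clC (A : set P) : btrigcl (\1_A) -> btrigcl (\1_(~` A)).
  move=> Acl; have -> : \1_(~` A) = (fun p => cst 1 p + -1 * \1_A p : R).
    by apply/funext => p; rewrite !indicE in_setC /=; case: (_ \in _) => /=; ring.
  by apply: btrigclD; [exact/btrigcl_trig/trig_cst|exact: btrigclZ].
have clI (A B : set P) : btrigcl (\1_A) -> btrigcl (\1_B) -> btrigcl (\1_(A `&` B)).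
  move=> Acl Bcl; have -> : \1_(A `&` B) = (fun p => \1_A p * \1_B p : R).
    by apply/funext => p; rewrite indicI.
  exact: btrigclM.
have clU (A B : set P) : btrigcl (\1_A) -> btrigcl (\1_B) -> btrigcl (\1_(A `|` B)).
  move=> Acl Bcl; rewrite -[A `|` B]setCK setCU.
  exact: (clC _ (clI _ _ (clC _ Acl) (clC _ Bcl))).
have cl0 : btrigcl (\1_(set0 : set P)).
  have -> : \1_(set0 : set P) = cst 0 :> (P -> R) by apply/funext => p; rewrite indicE in_set0.
  exact/btrigcl_trig/trig_cst.
split => /=.
- exact: cl0.
- by move=> A; rewrite setTD; exact: clC.
- move=> A Acl.
  apply: (btrigcl_cvg (F := fun n => \1_(\bigcup_(i < n) A i)) (M := 1)) => //.
    elim=> [|n IH]; first by rewrite bigcup_mkord big_ord0.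
    by rewrite bigcup_mkord big_ord_recr/= -bigcup_mkord; exact: clU.
  move=> p; apply: cvg_near_cst.
  have [[k _ Akp]|nA] := pselect ((\bigcup_k A k) p).
    near=> n; rewrite !indicE !mem_set//; first by exists k.
    by exists k => //=; near: n; exact: nbhs_infty_gt.
  near=> n; rewrite !indicE !memNset// => -[k _ Akp]; apply: nA; by exists k.
Unshelve. all: by end_near. Qed.

(** Membership passes from generators to the generated sigma-algebra ([preim]). For each coordinate
    the generators are open rays, that is, half-planes parallel to an axis; for the product they are
    cylinders over Borel sets, combined by intersection. *)
Lemma btrigcl_indic_borel (A : set RR) : measurable A ->
  btrigcl (\1_((fun p => (X p, Y p) : RR) @^-1` A)).
Proof.
have [cl0 clD clU] := sigma_algebra_btrigcl.
have clC (B : set P) : btrigcl (\1_B) -> btrigcl (\1_(~` B)).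
  by move=> Bcl; rewrite -setTD; exact: clD.
have preim (T : Type) (phi : P -> T) (G : set (set T)) :
    (forall B, G B -> btrigcl (\1_(phi @^-1` B))) ->
    forall B, <<s G >> B -> btrigcl (\1_(phi @^-1` B)).
  move=> HG; apply: smallest_sub; last exact: HG.
  split => /=; first by rewrite preimage_set0.
    by move=> B Bcl; rewrite setTD preimage_setC; exact: clC.
  by move=> F Fcl; rewrite preimage_bigcup; exact: clU.
have one (proj : P -> R) : (forall c, btrigcl (\1_[set p : P | 0 < proj p + c])) ->
    forall B : set (measurableTypeR R), measurable B -> btrigcl (\1_(proj @^-1` B)).
  move=> Hproj B.
  have -> : measurable B = (@RGenOInfty.G R).-sigma.-measurable B by rewrite -RGenOInfty.measurableE.
  apply: preim => _ [x ->] /=; have := Hproj (- x); congr (btrigcl (\1_ _)).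
  by apply/seteqP; split => p /=; rewrite in_itv/= andbT subr_gt0.
rewrite measurable_prod_measurableType; apply: preim => _ [B mB [C mC <-]] /=.
have -> : (fun p => (X p, Y p) : RR) @^-1` (B `*` C) = (X @^-1` B) `&` (Y @^-1` C) by [].
rewrite indicI; apply: btrigclM; apply: one => // c.
  have := btrigcl_indic_halfplane 1 0 c; congr (btrigcl (\1_ _)).
  by apply/seteqP; split => p /=; rewrite mul1r mul0r addr0.
have := btrigcl_indic_halfplane 0 1 c; congr (btrigcl (\1_ _)).
by apply/seteqP; split => p /=; rewrite mul1r mul0r add0r.
Qed.

End trig_closure.

(** For A inside B, the L^1 distance of the indicators is the measure of the difference. This
    carries the closure from Borel sets to sets measurable only after completion. *)
Lemma btrigcl_indic_approx (R : realType) d (P : measurableType d)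
    (mu : {finite_measure set P -> \bar R}) (X Y : P -> R) (A : set P) :
  measurable_fun setT X -> measurable_fun setT Y -> measurable A ->
  (forall e : R, 0 < e -> exists B, [/\ measurable B, btrigcl mu X Y (\1_B),
     A `<=` B & (mu (B `\` A) <= e%:E)%E]) ->
  btrigcl mu X Y (\1_A).
Proof.
move=> mX mY mA H; split; last first.
  by exists 1 => p; rewrite indicE; case: (_ \in _); rewrite ?normr1 ?normr0.
apply: trigcl_lim => // e e0.
have [B [mB [Bcl _] AB muBA]] := H _ e0.
exists (\1_B) => //; apply: le_trans muBA; rewrite /L1dist.
rewrite -(setIT (B `\` A)) -integral_indic//; last exact: measurableD.
rewrite le_eqVlt; apply/orP; left; apply/eqP; apply: eq_integral => p _.
rewrite !indicE in_setD; congr EFin.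
have [pA|pA] := boolP (p \in A); last first.
  by rewrite /= andbT sub0r normrN; case: (_ \in B); rewrite ?normr1 ?normr0.
by rewrite mem_set ?subrr ?normr0//; apply: AB; rewrite -in_setE.
Qed.

(** The outer measure is an infimum over countable measurable covers; B is the union of a cover that
    is optimal up to [e]. *)
Lemma mu_ext_cover (R : realType) d (T : measurableType d)
    (mu : {measure set T -> \bar R}) (A : set T) (e : R) :
  (mu^*%mu A < +oo)%E -> 0 < e ->
  exists B, [/\ measurable B, A `<=` B & (mu B <= mu^*%mu A + e%:E)%E].
Proof.
move=> Aoo e0.
have : mu^*%mu A \is a fin_num by rewrite ge0_fin_numE ?mu_ext_ge0.
move=> /lb_ereal_inf_adherent => /(_ _ e0)[_ /= [F [mF AF] <-]] /ltW Fe.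
exists (\bigcup_k F k); split => //; first exact: bigcupT_measurable.
apply: le_trans Fe; apply: measure_sigma_subadditive => //.
exact: bigcupT_measurable.
Qed.

(** * Riemann-Lebesgue lemma and uniqueness of the Fourier transform, from density *)

Section trig_dense.
Import HBSimple.
Context {R : realType} {d : measure_display} {P : measurableType d}.
Variables (mu : {finite_measure set P -> \bar R}) (X Y : P -> R).
Hypotheses (mX : measurable_fun setT X) (mY : measurable_fun setT Y).
Hypothesis indic_cl : forall A, measurable A -> btrigcl mu X Y (\1_A).
Implicit Types f g h : P -> R.

Lemma trigcl_sfun (g : {sfun P >-> R}) : trigcl mu X Y g.
Proof.
have [s gs] : exists s : seq R, forall p, g p = \sum_(y <- s) (y * \1_(g @^-1` [set y]) p).
  exists (finmap.enum_fset (fset_set (range g))) => p.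
  by rewrite {1}(fimfunE g p) fsbig_finite.
rewrite (_ : (g : P -> R) = fun p => \sum_(y <- s) (y * \1_(g @^-1` [set y]) p)); last exact/funext.
elim: s {gs} => [|y s IH].
  under eq_fun do rewrite big_nil.
  by apply: trigcl_trig => //; exact: trig_cst.
under eq_fun do rewrite big_cons.
apply: trigclD => //; apply: trigcl_trigM => //; first exact: trig_cst.
by have [] := indic_cl (measurable_sfunP g (measurable_set1 y)).
Qed.

Lemma trigcl_integrable f : mu.-integrable setT (EFin \o f) -> trigcl mu X Y f.
Proof.
move=> intf.
have mf : measurable_fun setT f by apply/measurable_EFinP; exact: measurable_int intf.
apply: trigcl_lim => // e e0.
have [g [_ _ /fine_cvgP[fin_ /cvgr_le /(_ _ e0) le_e]]] :=
  approximation_sfun_integrable measurableT intf.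
near \oo => n; exists (g n); first exact: trigcl_sfun.
rewrite /L1dist.
have -> : (\int[mu]_p (`|f p - g n p|)%:E = \int[mu]_p `|(EFin \o f) p - (g n p)%:E|)%E.
  by apply: eq_integral.
rewrite -[X in (X <= _)%E]fineK; last by near: n.
by rewrite lee_fin; near: n.
Unshelve. all: by end_near. Qed.

Let wave a b c p := cos (a * X p + b * Y p + c).

Let mwave a b c : measurable_fun setT (wave a b c).
Proof.
have -> : wave a b c = fun p => 1 * cos (a * X p + b * Y p + c).
  by apply/funext => p; rewrite mul1r.
by apply: measurable_trig; [exact: mX|exact: mY|exact: trig_cos].
Qed.

Let wave_le1 a b c p : `|wave a b c p| <= 1.
Proof. by rewrite ler_norml cos_geN1 cos_le1. Qed.

Lemma integrable_bM f h (M : R) : measurable_fun setT h -> (forall p, `|h p| <= M) ->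
  mu.-integrable setT (EFin \o f) -> mu.-integrable setT (EFin \o (fun p => h p * f p)).
Proof.
move=> mh hM intf.
have mf : measurable_fun setT f by apply/measurable_EFinP; exact: measurable_int intf.
have iMf : mu.-integrable setT (fun p => M%:E * (EFin \o f) p)%E by exact: integrableZl.
apply: le_integrable iMf => //.
  by apply/measurable_EFinP; exact: measurable_funM.
move=> p _ /=; rewrite !normrM lee_fin ler_wpM2r//.
exact: le_trans (hM p) (ler_norm _).
Qed.

Lemma integrable_trig h : trig X Y h -> mu.-integrable setT (EFin \o h).
Proof.
move=> th; have [M hM] := trig_bounded th.
by apply: (@fin_bounded_integrable _ _ _ mu h M) => //; exact: measurable_trig th.
Qed.

(** Pairing with a bounded weight is Lipschitz for the L^1 distance. The weight is a wave for the
    Riemann-Lebesgue lemma and the function itself for uniqueness. *)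
Lemma Rintegral_L1dist (w : P -> R) f h (M e : R) : measurable_fun setT w -> (forall p, `|w p| <= M) ->
  mu.-integrable setT (EFin \o f) -> mu.-integrable setT (EFin \o h) ->
  (L1dist mu f h <= e%:E)%E ->
  `|(\int[mu]_p (w p * f p)) - (\int[mu]_p (w p * h p))| <= M * e.
Proof.
move=> mw wM intf inth fhe.
have M0 : 0 <= M by apply: le_trans (wM point).
have ifh : mu.-integrable setT (EFin \o (fun p => f p - h p)).
  by have := integrableB measurableT intf inth.
have iwf := integrable_bM mw wM intf; have iwh := integrable_bM mw wM inth.
rewrite -RintegralB//.
have iw : mu.-integrable setT (EFin \o (fun p => w p * f p - w p * h p)).
  by have := integrableB measurableT iwf iwh.
apply: le_trans (le_normr_Rintegral measurableT iw) _.
have iafh : mu.-integrable setT (EFin \o (fun p => `|f p - h p|)).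
  exact: (integrable_abse ifh).
apply: (@le_trans _ _ (\int[mu]_p (M * `|f p - h p|))).
  apply: le_Rintegral => //.
  - exact: (integrable_abse iw).
  - exact: (integrableZl measurableT M iafh).
  - by move=> p _; rewrite -mulrBr normrM ler_wpM2r.
rewrite RintegralZl// ler_wpM2l//.
rewrite -lee_fin /Rintegral fineK//.
exact: (integrable_fin_num measurableT iafh).
Qed.

(** This is the Riemann-Lebesgue lemma for the constant function 1, with a rate uniform in the
    phase; it is established separately for the Gaussian measure. *)
Hypothesis decay : exists C : R, forall a b c : R,
  `|\int[mu]_p wave a b c p| * `|a| <= C /\ `|\int[mu]_p wave a b c p| * `|b| <= C.

Let wave_small (e : R) : 0 < e -> exists2 D : R, 0 <= D & forall a b c : R, (D <= `|a|) || (D <= `|b|) ->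
  `|\int[mu]_p wave a b c p| <= e.
Proof.
move=> e0; have [C HC] := decay.
have C0 : 0 <= C.
  by have [+ _] := HC 0 0 0; apply: le_trans; rewrite mulr_ge0.
exists (C / e + 1); first by rewrite addr_ge0// divr_ge0// ltW.
have Ce : 0 <= C / e by rewrite divr_ge0// ltW.
have aux (I x : R) : 0 <= I -> I * x <= C -> C / e + 1 <= x -> I <= e.
  move=> I0 Ix xD; rewrite leNgt; apply/negP => eI.
  have : C < I * x; last by rewrite ltNge Ix.
  have CE : C = e * (C / e) by rewrite mulrC divfK// gt_eqF.
  apply: (@lt_le_trans _ _ (e * x)); last by rewrite ler_wpM2r// ltW//; lra.
  by rewrite CE ltr_pM2l//; lra.
move=> a b c; have [Ha Hb] := HC a b c.
by case/orP => h; [exact: aux Ha h|exact: aux Hb h].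
Qed.

(** For a single cosine, the product with a wave is a combination of two waves of shifted frequency,
    to which [decay] applies. Sums follow by induction and integrable functions by L^1
    approximation, uniformly in the frequency since waves are bounded by 1. *)
Lemma riemann_lebesgue f : mu.-integrable setT (EFin \o f) ->
  forall e : R, 0 < e -> exists A : R, forall a b c : R, (A <= `|a|) || (A <= `|b|) ->
    `|\int[mu]_p (cos (a * X p + b * Y p + c) * f p)| <= e.
Proof.
move=> intf e e0; have e20 : 0 < e / 2 by rewrite divr_gt0.
have RLtrig h : trig X Y h -> forall e : R, 0 < e -> exists A : R, forall a b c : R,
    (A <= `|a|) || (A <= `|b|) -> `|\int[mu]_p (wave a b c p * h p)| <= e.
  elim => [k a' b' c'|{}f' g tf IH1 tg IH2] {e20 e e0}e e0.
    have e'0 : 0 < e / (`|k| + 1) by rewrite divr_gt0// ltr_wpDl.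
    have [D D0 HD] := wave_small e'0.
    (* Shifting by a' and b', with either sign, then still leaves one of the two frequencies at
       least [D] in absolute value. *)
    exists (`|a'| + `|b'| + D) => a b c H.
    have -> : \int[mu]_p (wave a b c p * (k * cos (a' * X p + b' * Y p + c'))) =
      k / 2 * (\int[mu]_p wave (a + a') (b + b') (c + c') p) +
      k / 2 * (\int[mu]_p wave (a - a') (b - b') (c - c') p).
      rewrite -!RintegralZl//; last 2 first.
      - exact: (@fin_bounded_integrable _ _ _ mu _ 1).
      - exact: (@fin_bounded_integrable _ _ _ mu _ 1).
      rewrite -RintegralD//; last 2 first.
      - by apply: (@integrable_bM _ (cst (k / 2)) `|k / 2|) => //; exact: (@fin_bounded_integrable _ _ _ mu _ 1).
      - by apply: (@integrable_bM _ (cst (k / 2)) `|k / 2|) => //; exact: (@fin_bounded_integrable _ _ _ mu _ 1).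
      apply: eq_Rintegral => p _; have := cosM_half 1 k (a * X p + b * Y p + c) (a' * X p + b' * Y p + c').
      by rewrite !mul1r => ->; congr (_ * cos _ + _ * cos _); ring.
    have big (x x' y y' : R) : (`|x'| + `|y'| + D <= `|x|) || (`|x'| + `|y'| + D <= `|y|) ->
       (D <= `|x + x'|) || (D <= `|y + y'|).
      have tri (s t : R) : `|s| <= `|s + t| + `|t|.
        by rewrite -{1}(addrK t s) (le_trans (ler_normB _ _)).
      have := tri x x'; have := tri y y'; have := normr_ge0 x'; have := normr_ge0 y'.
      by move=> h1 h2 h3 h4 /orP[h5|h5]; apply/orP; [left|right]; lra.
    apply: le_trans (ler_normD _ _) _; rewrite !normrM.
    have I1 := HD _ _ (c + c') (big _ _ _ _ H).
    have I2 : `|\int[mu]_p wave (a - a') (b - b') (c - c') p| <= e / (`|k| + 1).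
      by apply: HD; apply: big; rewrite !normrN.
    have k0 : 0 <= `|k| * `|2^-1| by rewrite mulr_ge0.
    apply: le_trans (lerD (ler_wpM2l k0 I1) (ler_wpM2l k0 I2)) _.
    rewrite normfV (@ger0_norm _ 2)//.
    have -> : `|k| / 2 * (e / (`|k| + 1)) + `|k| / 2 * (e / (`|k| + 1)) = e * (`|k| / (`|k| + 1)).
      by field; rewrite gt_eqF// ltr_wpDl.
    by rewrite ler_piMr ?(ltW e0)// ler_pdivrMr ?ltr_wpDl// mul1r lerDl.
  have e20 : 0 < e / 2 by rewrite divr_gt0.
  have [A1 H1] := IH1 _ e20; have [A2 H2] := IH2 _ e20.
  exists (Num.max A1 A2) => a b c.
  rewrite !ge_max => H.
  have -> : \int[mu]_p (wave a b c p * (f' p + g p)) =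
     (\int[mu]_p (wave a b c p * f' p)) + (\int[mu]_p (wave a b c p * g p)).
    rewrite -RintegralD//; try by apply: (integrable_bM (M := 1)) => //; exact: integrable_trig.
    by apply: eq_Rintegral => p _; rewrite mulrDr.
  rewrite (le_trans (ler_normD _ _))// [leRHS]splitr lerD//.
    by apply: H1; case/orP: H => /andP[h1 h2]; apply/orP; [left|right].
  by apply: H2; case/orP: H => /andP[h1 h2]; apply/orP; [left|right].
have [_ /(_ _ e20)[h th fh]] := trigcl_integrable intf.
have [A HA] := RLtrig _ th _ e20.
exists A => a b c Aab.
have := Rintegral_L1dist (mwave a b c) (wave_le1 a b c) intf (integrable_trig th) fh.
rewrite mul1r => I1.
rewrite -[X in `|X|](subrK (\int[mu]_p (wave a b c p * h p))).
by rewrite (le_trans (ler_normD _ _))// [leRHS]splitr lerD// HA.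
Qed.

(** Being orthogonal to every trigonometric polynomial h, a bounded f satisfies that the integral of
    f^2 equals that of f (f - h). The latter is at most M times the L^1 distance of f to h, hence
    arbitrarily small. *)
Lemma fourier_unique f (M : R) : measurable_fun setT f -> (forall p, `|f p| <= M) ->
  (forall a b c, \int[mu]_p (cos (a * X p + b * Y p + c) * f p) = 0) ->
  {ae mu, forall p, f p = 0}.
Proof.
move=> mf fM f0.
have intf : mu.-integrable setT (EFin \o f) by exact: (@fin_bounded_integrable _ _ _ mu f M).
have trig0 h : trig X Y h -> \int[mu]_p (f p * h p) = 0.
  elim => [k a b c|{}h g th IH1 tg IH2].
    transitivity (\int[mu]_p (k * (wave a b c p * f p))).
      by apply: eq_Rintegral => p _; rewrite /wave; ring.
    by rewrite RintegralZl ?f0 ?mulr0//; exact: (integrable_bM (M := 1)).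
  have -> : \int[mu]_p (f p * (h p + g p)) =
     (\int[mu]_p (f p * h p)) + (\int[mu]_p (f p * g p)).
    rewrite -RintegralD//; try by apply: (integrable_bM (M := M)) => //; exact: integrable_trig.
    by apply: eq_Rintegral => p _; rewrite mulrDr.
  by rewrite IH1 IH2 addr0.
have M0 : 0 <= M by apply: le_trans (fM point).
have iff : mu.-integrable setT (EFin \o (fun p => f p * f p)) by exact: (integrable_bM (M := M)).
have int0 : \int[mu]_p (f p * f p) = 0.
  apply/eqP; rewrite -normr_le0; apply/ler_addgt0Pr => e e0; rewrite add0r.
  have e'0 : 0 < e / (M + 1) by rewrite divr_gt0//; lra.
  have [_ /(_ _ e'0)[h th fh]] := trigcl_integrable intf.
  have := Rintegral_L1dist mf fM intf (integrable_trig th) fh.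
  rewrite (trig0 _ th) subr0 => /le_trans; apply.
  by rewrite mulrCA ler_piMr ?(ltW e0)// ler_pdivrMr//; lra.
pose ff p := f p * f p.
have mff : measurable_fun setT (EFin \o ff) by exact: measurable_int iff.
have int0' : (\int[mu]_p `|(EFin \o ff) p| = 0)%E.
  transitivity (\int[mu]_p ((EFin \o ff) p))%E.
    by apply: eq_integral => p _; rewrite gee0_abs// lee_fin /ff -expr2 sqr_ge0.
  rewrite -[LHS]fineK; last exact: (integrable_fin_num measurableT iff).
  by congr EFin; exact: int0.
have := (ae_eq_integral_abs mu measurableT mff).1 int0'.
apply: filterS => p /(_ I) /= [/eqP].
by rewrite mulf_eq0 orbb => /eqP.
Qed.

End trig_dense.

(** * The Gaussian measure of the plane *)

(** The density g and the Radon-Nikodym derivative of [m] have the same integral over each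
    measurable set, so they agree almost everywhere and the change of variables for the derivative
    holds for g. *)
Lemma ge0_integral_density d (T : measurableType d) (R : realType)
    (m : {finite_measure set T -> \bar R})
    (mu : {sigma_finite_measure set T -> \bar R}) (g : T -> R) (f : T -> \bar R) :
  measurable_fun setT g ->
  (forall A, measurable A -> m A = \int[mu]_(x in A) (g x)%:E)%E ->
  measurable_fun setT f -> (forall x, 0 <= f x)%E ->
  (\int[m]_x f x = \int[mu]_x (f x * (g x)%:E))%E.
Proof.
move=> mg mE mf f0.
have mEg A : measurable_fun A (EFin \o g).
  by apply/measurable_EFinP; exact: measurable_funTS.
have dom : m `<< mu.
  by apply/null_content_dominatesP => A mA A0; rewrite mE// null_set_integral.
rewrite -(Radon_Nikodym_SigmaFinite.change_of_variables dom)//.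
have iRN := Radon_Nikodym_SigmaFinite.f_integrable dom.
have mRN := measurable_int _ iRN.
apply: ae_eq_integral => //; [exact: emeasurable_funM|exact: emeasurable_funM|].
apply: ae_eqe_mul2l; apply: integral_ae_eq => // E _ mE'.
by rewrite -(Radon_Nikodym_SigmaFinite.f_integral dom)// mE.
Qed.

Section gauss_plane.
Context {R : realType}.
Local Notation P := (plane R).
Local Notation RR := (measurableTypeR R * measurableTypeR R)%type.
Local Notation leb := (@lebesgue_measure R).

Let idp (p : P) : RR := p.

Lemma measurable_fun_plane d (T : measurableType d) (f : RR -> T) :
  measurable_fun [set: RR] f -> measurable_fun [set: P] (f : P -> T).
Proof.
move=> mf _ B mB; rewrite setTI; apply: measurable_plane.
by rewrite -[X in measurable X]setTI; exact: mf.
Qed.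

Lemma measurable_idp : measurable_fun [set: P] idp.
Proof. exact: (@measurable_fun_plane _ RR id). Qed.

Lemma lambdaE (A : set RR) : measurable A -> lambda A = borel_lebesgue2 A.
Proof. by move=> mA; exact: measurable_mu_extE. Qed.

(** The identity from the completed plane to the product space pushes [lambda] forward to the
    product measure. Tonelli's theorem thereby becomes available for Borel integrands. *)
Lemma ge0_integral_lambda (f : RR -> \bar R) : measurable_fun [set: RR] f ->
  (forall p, 0 <= f p)%E ->
  (\int[lambda]_(p in [set: P]) f p = \int[borel_lebesgue2]_p f p)%E.
Proof.
move=> mf f0.
have := @ge0_integral_pushforward _ _ P RR R idp measurable_idp lambda setT f.
rewrite preimage_setT => <- //.
apply: eq_measure_integral; first exact: measurable_idp.
by move=> mp A mA _; exact: lambdaE.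
Qed.

Lemma lambda_sigma_finite : sigma_finite [set: P] (@lambda R).
Proof.
apply: completed_measure_extension_sigma_finite.
pose I n : set (measurableTypeR R) := `[- n%:R, n%:R]%classic.
exists (fun n => I n `*` I n).
  apply/seteqP; split => // -[x y] _.
  have [n xyn] : exists n : nat, `|x| + `|y| <= n%:R.
    exists (Num.truncn (`|x| + `|y|)).+1.
    by rewrite ltW// truncnS_gt.
  exists n => //; split; rewrite /I /= in_itv/= -ler_norml;
    apply: le_trans xyn; [rewrite lerDl|rewrite lerDr]; exact: normr_ge0.
have mI n : measurable (I n) by exact: measurable_itv.
move=> n; split; first exact: measurableX.
rewrite /borel_lebesgue2 /= product_measure1E//.
have lI : (leb (I n) < +oo)%E.
  by rewrite /I lebesgue_measure_itv/=; case: ifP; rewrite ltry.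
by rewrite lte_mul_pinfty// ge0_fin_numE.
Qed.

HB.instance Definition _ := Measure_isSigmaFinite.Build _ _ _
  (@completed_measure_extension _ _ _ (@borel_lebesgue2 R)) lambda_sigma_finite.

Let lambda_sf : {sigma_finite_measure set P -> \bar R} :=
  @completed_measure_extension _ _ _ (@borel_lebesgue2 R).

Lemma gauss_densityE (p : P) : gauss_density p =
  (gauss_fun p.1 / Num.sqrt pi) * (gauss_fun p.2 / Num.sqrt pi).
Proof.
rewrite /gauss_density /gauss_fun /= sqr_sqrtr; last first.
  by rewrite addr_ge0 ?sqr_ge0.
rewrite opprD expRD mulrACA -invfM -expr2 sqr_sqrtr ?pi_ge0//.
by rewrite mulrC.
Qed.

Lemma gauss_density_gt0 (p : P) : 0 < gauss_density p.
Proof. by rewrite mulr_gt0 ?expR_gt0// invr_gt0 pi_gt0. Qed.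

Lemma measurable_gauss_density2 :
  measurable_fun [set: RR] (gauss_density : RR -> R).
Proof.
have -> : (gauss_density : RR -> R) = fun p =>
  (gauss_fun p.1 / Num.sqrt pi) * (gauss_fun p.2 / Num.sqrt pi).
  by apply/funext => p; exact: gauss_densityE.
by apply: measurable_funM; apply: measurable_funM => //;
  apply: measurableT_comp => //; exact: measurable_gauss_fun.
Qed.

Lemma ge0_integral_gauss_prod (f g : R -> R) :
  measurable_fun setT f -> measurable_fun setT g ->
  (forall x, 0 <= f x) -> (forall x, 0 <= g x) ->
  (\int[lambda]_(p in [set: P]) (f p.1 * g p.2 * gauss_density p)%:E =
   (\int[leb]_x (f x * (gauss_fun x / Num.sqrt pi))%:E) *
   (\int[leb]_x (g x * (gauss_fun x / Num.sqrt pi))%:E))%E.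
Proof.
move=> mf mg f0 g0.
pose F (h : R -> R) x := (h x * (gauss_fun x / Num.sqrt pi)).
have F0 h : (forall x, 0 <= h x) -> forall x, 0 <= F h x.
  by move=> h0 x; rewrite /F mulr_ge0// mulr_ge0 ?gauss_fun_ge0// invr_ge0.
have mF h : measurable_fun setT h -> measurable_fun setT (F h).
  move=> mh; apply: measurable_funM => //; apply: measurable_funM => //.
  exact: measurable_gauss_fun.
pose H (p : RR) := ((F f p.1)%:E * (F g p.2)%:E)%E.
have mH : measurable_fun setT H.
  by apply: emeasurable_funM; apply/measurable_EFinP;
     apply: measurableT_comp => //; apply: mF.
transitivity (\int[lambda]_(p in [set: P]) H p)%E.
  apply: eq_integral => p _; rewrite /H /F -EFinM gauss_densityE.
  by congr EFin; ring.
have H0 p : (0 <= H p)%E by rewrite mule_ge0// lee_fin F0.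
rewrite ge0_integral_lambda// /borel_lebesgue2 fubini_tonelli1//.
rewrite /fubini_F/= /H /=.
under eq_integral => x _.
  rewrite ge0_integralZl//=; last by rewrite lee_fin F0.
    over.
  - by apply/measurable_EFinP; apply: mF.
  - by move=> y _; rewrite lee_fin F0.
rewrite ge0_integralZr//.
- by apply/measurable_EFinP; apply: mF.
- by move=> y _; rewrite lee_fin F0.
- by apply: integral_ge0 => y _; rewrite lee_fin F0.
Qed.

(** Completing the square: exp(c x) times the centred normal density of variance 1/2 is exp(c^2 / 4)
    times the normal density of mean c / 2 and the same variance, [s] being the standard
    deviation. *)
Lemma integral_exp_gauss_lty (c : R) :
  (\int[leb]_x (expR (c * x) * (gauss_fun x / Num.sqrt pi))%:E < +oo)%E.
Proof.
pose s : R := (Num.sqrt 2)^-1.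
have s0 : s != 0 by rewrite invr_eq0 sqrtr_eq0 -ltNge.
have s2 : s ^+ 2 *+ 2 = 1.
  by rewrite exprVn sqr_sqrtr// -[LHS]mulr_natr mulVf.
have E x : expR (c * x) * (gauss_fun x / Num.sqrt pi) =
    expR (c ^+ 2 / 4) * normal_pdf (c / 2) s x.
  rewrite normal_pdfE// /normal_peak /normal_fun -mulrnAl s2 mul1r divr1.
  rewrite /gauss_fun mulrA -expRD mulrCA -expRD mulrC; congr (_ * expR _).
  by field.
under eq_integral do rewrite E EFinM.
rewrite integralZl//; last exact: integrable_normal_pdf.
by rewrite integral_normal_pdf mule1 ltry.
Qed.

Lemma nu_setT_lty : (nu [set: P] < +oo)%E.
Proof.
rewrite /nu.
have := ge0_integral_gauss_prod (@measurable_cst _ _ R R setT 1)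
  (@measurable_cst _ _ R R setT 1) (fun _ => ler01) (fun _ => ler01).
under eq_integral do rewrite mulr1 mul1r.
move=> ->.
have := @integral_exp_gauss_lty 0.
under eq_integral do rewrite mul0r expR0.
move=> h; apply: lte_mul_pinfty => //.
  by apply: integral_ge0 => x _; rewrite lee_fin mulr_ge0// mulr_ge0 ?gauss_fun_ge0 ?invr_ge0.
rewrite ge0_fin_numE//; apply: integral_ge0 => x _.
by rewrite lee_fin mulr_ge0// mulr_ge0 ?gauss_fun_ge0 ?invr_ge0.
Qed.

HB.instance Definition _ := Measure_isFinite.Build _ _ _ (@nu R)
  (lty_fin_num_fun nu_setT_lty).

(** The Gaussian density is positive everywhere. Uniqueness, proved almost everywhere for [nu], is
    thus transferred to Lebesgue measure. *)
Lemma nu_null (A : set P) : measurable A -> nu A = 0%E -> lambda A = 0%E.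
Proof.
move=> mA /= nA.
have mg : measurable_fun A (EFin \o (@gauss_density R)).
  by apply/measurable_EFinP; apply: measurable_funTS; exact: measurable_gauss_density.
have : (\int[lambda]_(p in A) `|(EFin \o (@gauss_density R)) p| = 0)%E.
  by rewrite -[RHS]nA; apply: eq_integral => p _ /=;
     rewrite ger0_norm// gauss_density_ge0.
move/(ae_eq_integral_abs lambda mA mg) => [N [mN N0 sN]].
apply/eqP; rewrite eq_le measure_ge0 andbT -N0; apply: le_measure; rewrite ?inE//.
by move=> p Ap; apply: sN => /(_ Ap) /=; case; apply/eqP; rewrite gt_eqF// gauss_density_gt0.
Qed.

Lemma ge0_integral_nu (f : P -> \bar R) : measurable_fun setT f ->
  (forall p, 0 <= f p)%E ->
  (\int[nu]_p f p = \int[lambda]_p (f p * (gauss_density p)%:E))%E.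
Proof.
move=> mf f0.
apply: (@ge0_integral_density _ P _ (@nu R) lambda_sf) => //.
exact: measurable_gauss_density.
Qed.

Lemma integral_exp_nu_lty (c d : R) :
  (\int[nu]_(p in [set: P]) (expR (c * p.1 + d * p.2))%:E < +oo)%E.
Proof.
have mexp (e : R) : measurable_fun [set: measurableTypeR R] (fun x : R => expR (e * x)).
  by apply: measurableT_comp => //; apply: measurable_funM.
rewrite ge0_integral_nu//; last first.
  apply/measurable_EFinP; apply: (@measurable_fun_plane _ _ (fun p => expR (c * p.1 + d * p.2))).
  by apply: measurableT_comp => //; apply: measurable_funD; apply: measurable_funM.
under eq_integral do rewrite -EFinM expRD.
rewrite (ge0_integral_gauss_prod (mexp c) (mexp d))//;
  try by move=> x; rewrite expR_ge0.
apply: lte_mul_pinfty; last exact: integral_exp_gauss_lty.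
  by apply: integral_ge0 => x _; rewrite lee_fin mulr_ge0 ?expR_ge0// mulr_ge0 ?gauss_fun_ge0 ?invr_ge0.
rewrite ge0_fin_numE; first exact: integral_exp_gauss_lty.
by apply: integral_ge0 => x _; rewrite lee_fin mulr_ge0 ?expR_ge0// mulr_ge0 ?gauss_fun_ge0 ?invr_ge0.
Qed.

End gauss_plane.

(** * Decay of the Fourier transform of the Gaussian measure *)

Section gauss_cos.
Context {R : realType}.
Local Notation leb := (@lebesgue_measure R).
Local Notation P := (plane R).
Local Notation RR := (measurableTypeR R * measurableTypeR R)%type.
Let g (x : R) : R := gauss_fun x / Num.sqrt pi.

Let g_ge0 x : 0 <= g x.
Proof. by rewrite mulr_ge0 ?gauss_fun_ge0// invr_ge0. Qed.

Let g_le x : g x <= (Num.sqrt pi)^-1.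
Proof. by rewrite ler_piMl ?gauss_fun_le1// invr_ge0. Qed.

Let mg : measurable_fun [set: measurableTypeR R] g.
Proof. by apply: measurable_funM => //; exact: measurable_gauss_fun. Qed.

Let int_g : (\int[leb]_x (g x)%:E = 1)%E.
Proof.
have s0 : Num.sqrt (pi : R) != 0 by rewrite sqrtr_eq0 -ltNge pi_gt0.
under eq_integral do rewrite /g EFinM.
rewrite integralZr//; last exact: integrableT_gauss.
by rewrite integralT_gauss -EFinM divff.
Qed.

(** The primitive for an integration by parts: its derivative [u'] is the wave times the density
    [g], plus a term carrying a factor 1 / a. *)
Let u (a c x : R) : R := sin (a * x + c) / a * g x.
Let u' (a c x : R) : R := cos (a * x + c) * g x + sin (a * x + c) / a * (- (2 * x) * g x).

Let is_derive_g (x : R) : is_derive x 1 (g : R^o -> R^o) (- (2 * x) * g x).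
Proof.
rewrite /g /gauss_fun.
have h : is_derive x (1 : R) (fun y : R => - y ^+ 2 : R) (- (2 * x)).
  apply: is_derive_eq; rewrite /= /GRing.scale /=.
  by ring.
have h2 := is_derive1_comp (is_derive_expR _) h.
apply: (@is_derive_eq _ _ _ (fun y => (expR \o (fun y : R => - y ^+ 2)) y * (Num.sqrt pi)^-1)).
rewrite /= /GRing.scale /=; ring.
Qed.

Let is_derive_u a c (x : R) : a != 0 -> is_derive x 1 (u a c : R^o -> R^o) (u' a c x).
Proof.
move=> a0; rewrite /u.
have h : is_derive x (1 : R) (fun y : R => a * y + c : R) a.
  apply: is_derive_eq; rewrite /= /GRing.scale /=; ring.
have h2 := is_derive1_comp (is_derive_sin _) h.
have h3 := is_derive_g x.
apply: (@is_derive_eq _ _ _ (fun y => (sin \o (fun y : R => a * y + c)) y * a^-1 * g y)).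
rewrite /= /GRing.scale /= /u'; field => //.
Qed.

(** An integrable majorant of |2 x g(x)|, the absolute value of the derivative of [g]; exponentials
    dominate |x| and their Gaussian integrals are already known to be finite. *)
Let g2 (x : R) : R := 2 * (expR x + expR (- x)) * g x.

Let mg2 : measurable_fun [set: measurableTypeR R] g2.
Proof.
apply: measurable_funM => //; apply: measurable_funM => //.
by apply: measurable_funD => //; apply: measurableT_comp.
Qed.

Let g2_ge0 x : 0 <= g2 x.
Proof. by apply: mulr_ge0 => //; apply: mulr_ge0 => //; apply: addr_ge0; exact: expR_ge0. Qed.

Let abs_le_exp (x : R) : `|x| <= expR x + expR (- x).
Proof.
have := expR_ge1Dx x; have := expR_ge1Dx (- x).
have := expR_ge0 x; have := expR_ge0 (- x).
case: (ger0P x) => x0; lra.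
Qed.

Let integrable_ge0 (f : R -> R) : measurable_fun [set: measurableTypeR R] f -> (forall x, 0 <= f x) ->
  (\int[leb]_x (f x)%:E < +oo)%E -> leb.-integrable setT (EFin \o f).
Proof.
move=> mf f0 fy; apply/integrableP; split; first exact/measurable_EFinP.
by under eq_integral do rewrite /= ger0_norm//.
Qed.

Let ig : leb.-integrable setT (EFin \o g).
Proof. by apply: integrable_ge0 => //; rewrite int_g ltry. Qed.

Let ig2 : leb.-integrable setT (EFin \o g2).
Proof.
have mE (c : R) : measurable_fun [set: measurableTypeR R] (fun x : R => expR (c * x) * g x).
  by apply: measurable_funM => //; apply: measurableT_comp => //; apply: measurable_funM.
have E0 (c x : R) : 0 <= expR (c * x) * g x by rewrite mulr_ge0 ?expR_ge0.
have iE c := integrable_ge0 (mE c) (E0 c) (integral_exp_gauss_lty c).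
pose e (c x : R) := expR (c * x) * g x.
have -> : EFin \o g2 = (fun x => 2%:E * ((EFin \o e 1%R) x + (EFin \o e (- 1)%R) x))%E.
  by apply/funext => x; rewrite /e /= -EFinD -EFinM mul1r mulN1r /g2; congr EFin; ring.
by apply: integrableZl => //; apply: integrableD => //; exact: iE.
Qed.

Let int_g2 : (\int[leb]_x (g2 x)%:E < +oo)%E.
Proof.
by have /integrableP[_] := ig2; under eq_integral do rewrite /= ger0_norm//.
Qed.

Let C0 : R := fine (\int[leb]_x (g2 x)%:E).

Let C0E : (\int[leb]_x (g2 x)%:E = C0%:E)%E.
Proof.
by rewrite /C0 fineK// ge0_fin_numE//; apply: integral_ge0 => x _; rewrite lee_fin.
Qed.

Let maff (a c : R) : measurable_fun [set: measurableTypeR R] (fun x : R => a * x + c : R).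
Proof. by apply: measurable_funD => //; apply: measurable_funM. Qed.

Let mcos (a c : R) : measurable_fun [set: measurableTypeR R] (fun x : R => cos (a * x + c)).
Proof.
apply: measurableT_comp; last exact: maff.
by apply: continuous_measurable_fun; exact: continuous_cos.
Qed.

Let msin (a c : R) : measurable_fun [set: measurableTypeR R] (fun x : R => sin (a * x + c)).
Proof.
apply: measurableT_comp; last exact: maff.
by apply: continuous_measurable_fun; exact: continuous_sin.
Qed.

Let mu' a c : measurable_fun [set: measurableTypeR R] (u' a c).
Proof.
apply: measurable_funD; first by apply: measurable_funM.
apply: measurable_funM; first by apply: measurable_funM.
by apply: measurable_funM => //; apply: measurableT_comp => //; apply: measurable_funM.
Qed.

Let u'_tail a c x : 0 < a -> `|sin (a * x + c) / a * (- (2 * x) * g x)| <= a^-1 * g2 x.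
Proof.
rewrite /g2; move: (g x) (g_ge0 x) => y y0 a0.
rewrite !normrM normrN normrM (ger0_norm y0) (gtr0_norm (x:=a^-1)) ?invr_gt0// (@ger0_norm _ 2)//.
rewrite [leLHS](_ : _ = a^-1 * (`|sin (a * x + c)| * `|x| * (2 * y))); last by ring.
apply: ler_wpM2l; first by rewrite invr_ge0 ltW.
rewrite [leRHS](_ : _ = (1 * (expR x + expR (- x))) * (2 * y)); last by ring.
rewrite ler_wpM2r ?mulr_ge0// ler_pM// ler_norml sin_geN1 sin_le1//.
Qed.

Let iu' a c : 0 < a -> leb.-integrable setT (EFin \o u' a c).
Proof.
move=> a0.
have ik : leb.-integrable setT (EFin \o (fun x => g x + a^-1 * g2 x)).
  have -> : EFin \o (fun x => g x + a^-1 * g2 x) =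
    (fun x => (EFin \o g) x + (a^-1)%:E * (EFin \o g2) x)%E by [].
  by apply: integrableD => //; exact: integrableZl.
apply: le_integrable ik => //; first exact/measurable_EFinP.
move=> x _ /=; rewrite lee_fin [leRHS]ger0_norm; last first.
  by rewrite addr_ge0// mulr_ge0// invr_ge0 ltW.
rewrite (le_trans (ler_normD _ _))// lerD//; last exact: u'_tail.
by rewrite normrM (ger0_norm (g_ge0 x)) ler_piMl// ler_norml cos_geN1 cos_le1.
Qed.

Let u_bound a c x : 0 < a -> `|u a c x| <= (Num.sqrt pi)^-1 / a.
Proof.
rewrite /u; move: (g x) (g_ge0 x) (g_le x) => y y0 yle a0.
rewrite !normrM (ger0_norm y0) (gtr0_norm (x:=a^-1)) ?invr_gt0//.
rewrite mulrAC; apply: ler_wpM2r; first by rewrite invr_ge0 ltW.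
rewrite -[leRHS]mul1r ler_pM//.
by rewrite ler_norml sin_geN1 sin_le1.
Qed.

(* The summand 1 makes the integrand nonnegative, so that Tonelli's theorem and
   monotone limits apply; as c is arbitrary and cos (t + pi) = - cos t, the upper
   bound is also a lower bound. *)
Lemma integral_1cos_gauss : exists C : R, forall a c : R, 0 < a ->
  (\int[leb]_x ((1 + cos (a * x + c)) * g x)%:E <= (1 + C / a)%:E)%E.
Proof.
(* [C0] accounts for the integrated tail, and the other summand for the two boundary values of [u],
   each at most 1 / (a sqrt pi) in modulus. *)
exists (C0 + (Num.sqrt pi)^-1 * 2) => a c a0.
have ai0 : 0 <= a^-1 by rewrite invr_ge0 ltW.
pose f x := (1 + cos (a * x + c)) * g x.
have f0 x : 0 <= f x by rewrite mulr_ge0//; have := cos_geN1 (a * x + c); lra.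
have mf : measurable_fun [set: measurableTypeR R] f by apply: measurable_funM => //; apply: measurable_funD.
(* Pointwise f is at most h + [u']: the tail of [u'] may be negative, but a^-1 times [g2]
   compensates for it. The integral of [u'] over an interval is computed from its endpoints. *)
pose h x := g x + a^-1 * g2 x.
have h0 x : 0 <= h x by rewrite addr_ge0// mulr_ge0.
have mh : measurable_fun [set: measurableTypeR R] h by apply: measurable_funD => //; apply: measurable_funM.
have ih : (\int[leb]_x (h x)%:E = (1 + C0 / a)%:E)%E.
  under eq_integral do rewrite /h EFinD (EFinM a^-1).
  rewrite integralD//; last by apply: integrableZl.
  by rewrite int_g integralZl// C0E -EFinM -EFinD (mulrC C0).
pose I (n : nat) : set (measurableTypeR R) := `[- n.+1%:R, n.+1%:R]%classic.
have mI n : measurable (I n) by exact: measurable_itv.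
have UI : \bigcup_n I n = setT.
  apply/seteqP; split => // x _; exists (Num.truncn `|x|) => //.
  by rewrite /I /= in_itv/= -ler_norml ltW// truncnS_gt.
have bound n : (\int[leb]_(x in I n) (f x)%:E <= (1 + (C0 + (Num.sqrt pi)^-1 * 2) / a)%:E)%E.
  have ihI : leb.-integrable (I n) (EFin \o h).
    apply: (integrableS measurableT) => //; apply: (integrable_ge0 mh h0).
    by rewrite ih ltry.
  have iu'I : leb.-integrable (I n) (EFin \o u' a c).
    by apply: (integrableS measurableT) => //; exact: iu'.
  have FTC : (\int[leb]_(x in I n) (u' a c x)%:E = (u a c n.+1%:R)%:E - (u a c (- n.+1%:R))%:E)%E.
    have cont_u : continuous (u a c : R^o -> R^o).
      move=> x; apply: differentiable_continuous; apply/derivable1_diffP.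
      by have [] := is_derive_u c x (lt0r_neq0 a0).
    apply: continuous_FTC2.
    - by rewrite gtrN.
    - apply: continuous_subspaceT => x.
      have cg y : {for y, continuous g}.
        apply: differentiable_continuous; apply/derivable1_diffP.
        by have [] := is_derive_g y.
      have ca : {for x, continuous (fun x => a * x + c)}.
        apply: cvgD; last exact: cvg_cst.
        by apply: cvgM; [exact: cvg_cst|exact: cvg_id].
      have cc : {for x, continuous (fun x => cos (a * x + c))}.
        exact: (@continuous_comp _ _ _ (fun x => a * x + c) cos x ca (@continuous_cos R _)).
      have cs : {for x, continuous (fun x => sin (a * x + c))}.
        exact: (@continuous_comp _ _ _ (fun x => a * x + c) sin x ca (@continuous_sin R _)).
      apply: cvgD; first exact: (cvgM cc (cg x)).
      apply: cvgM; first exact: (cvgM cs (cvg_cst _)).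
      apply: (cvgM _ (cg x)); apply: cvgN.
      exact: (cvgM (cvg_cst _) cvg_id).
    - split.
      + by move=> x _; have [] := is_derive_u c x (lt0r_neq0 a0).
      + by apply: cvg_at_right_filter; exact: cont_u.
      + by apply: cvg_at_left_filter; exact: cont_u.
    - move=> x _; rewrite derive1E.
      by have [_ ->] := is_derive_u c x (lt0r_neq0 a0).
  apply: (@le_trans _ _ (\int[leb]_(x in I n) ((h x)%:E + (u' a c x)%:E))%E).
    apply: ge0_le_integral => //.
    - by move=> x _; rewrite lee_fin.
    - by apply/measurable_EFinP; exact: measurable_funTS.
    - by apply: emeasurable_funD; apply/measurable_EFinP; apply: measurable_funTS.
    - move=> x _; rewrite -EFinD lee_fin /f /h /u' mulrDl mul1r.
      have := u'_tail c x a0; rewrite ler_norml => /andP[+ _]; lra.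
  rewrite integralD// FTC.
  rewrite [leRHS](_ : _ = (1 + C0 / a)%R%:E + ((Num.sqrt pi)^-1 * 2 / a)%R%:E)%E; last first.
    by rewrite -EFinD; congr EFin; ring.
  apply: leeD.
    rewrite -ih; apply: ge0_subset_integral => //; first exact/measurable_EFinP.
    by move=> x _; rewrite lee_fin.
  rewrite -EFinB lee_fin.
  have := u_bound c n.+1%:R a0; have := u_bound c (- n.+1%:R) a0.
  rewrite !ler_norml => /andP[+ _] /andP[_ +].
  by rewrite mulrAC; lra.
have ndI : nondecreasing_seq I.
  move=> n m nm; apply/subsetPset => x; rewrite /I /= !in_itv/= -!ler_norml.
  by move=> /le_trans; apply; rewrite ler_nat ltnS.
have mfI i : measurable_fun (I i) (EFin \o f) by apply/measurable_EFinP; exact: measurable_funTS.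
have := @ge0_nondecreasing_set_cvg_integral _ _ R I (EFin \o f) leb ndI mI mfI.
rewrite UI => cvgI.
have {}cvgI := cvgI (fun i x _ => f0 x).
rewrite -(cvg_lim _ cvgI)//; apply: lime_le.
  by apply/cvg_ex; eexists; exact: cvgI.
by apply: nearW => n; exact: bound.
Qed.

Let measurable_cos_plane (a b c : R) :
  measurable_fun [set: RR] (fun p : RR => cos (a * p.1 + b * p.2 + c)).
Proof.
apply: measurableT_comp.
  by apply: continuous_measurable_fun; exact: continuous_cos.
by apply: measurable_funD => //; apply: measurable_funD; apply: measurable_funM.
Qed.

Let densE (x y : R) : gauss_density ((x, y) : P) = g x * g y.
Proof. exact: gauss_densityE. Qed.

Lemma nu_setT : nu [set: P] = 1%E.
Proof.
have := ge0_integral_gauss_prod (@measurable_cst _ _ (measurableTypeR R) R setT 1)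
  (@measurable_cst _ _ (measurableTypeR R) R setT 1) (fun _ => ler01) (fun _ => ler01).
under eq_integral do rewrite mulr1 mul1r.
by rewrite /nu => ->; under eq_integral do rewrite mul1r; rewrite int_g mule1.
Qed.

(** Tonelli with the variable of frequency [a] integrated first; the other coordinate is absorbed in
    the phase, over which the one-dimensional bound is uniform. [sw] tells which coordinate carries
    [a]. *)
Let integral_1cos_nu (sw : bool) : exists C : R, forall a b c : R, 0 < a ->
  (\int[nu]_(p in [set: P]) (1 + cos (if sw then b * p.1 + a * p.2 + c
     else a * p.1 + b * p.2 + c))%:E <= (1 + C / a)%:E)%E.
Proof.
have [C HC] := integral_1cos_gauss; exists C => a b c a0.
have C0' : (0 <= (1 + C / a)%:E)%E.
  apply: le_trans (HC a c a0); apply: integral_ge0 => x _.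
  by rewrite lee_fin mulr_ge0//; have := cos_geN1 (a * x + c); lra.
pose f (p : RR) := (1 + cos (if sw then b * p.1 + a * p.2 + c else a * p.1 + b * p.2 + c)).
have f0 p : 0 <= f p by rewrite /f; set z := (X in cos X); have := cos_geN1 z; lra.
have mf : measurable_fun setT f.
  by apply: measurable_funD => //; case: (sw); exact: measurable_cos_plane.
rewrite (@ge0_integral_nu _ (EFin \o f)); last 2 first.
- apply/measurable_EFinP; exact: (measurable_fun_plane mf).
- by move=> p; rewrite lee_fin.
rewrite (@ge0_integral_lambda _ (fun p => (EFin \o f) p * (gauss_density p)%:E)%E); last 2 first.
- by apply: emeasurable_funM; apply/measurable_EFinP => //; exact: measurable_gauss_density2.
- by move=> p; rewrite mule_ge0// lee_fin ?f0// gauss_density_ge0.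
have mF : measurable_fun setT (fun p : RR => (EFin \o f) p * (gauss_density p)%:E)%E.
  by apply: emeasurable_funM; apply/measurable_EFinP => //; exact: measurable_gauss_density2.
have F0 (p : RR) : (0 <= (EFin \o f) p * (gauss_density p)%:E)%E.
  by rewrite mule_ge0// lee_fin ?f0// gauss_density_ge0.
have intg : ((\int[leb]_y ((1 + C / a)%:E * (g y)%:E))%E <= (1 + C / a)%:E)%E.
  by rewrite ge0_integralZl// ?int_g ?mule1//; [exact/measurable_EFinP|move=> x _; rewrite lee_fin].
have inner y : (\int[leb]_x (((1 + cos (a * x + (b * y + c))) * g x)%:E * (g y)%:E) <=
    (1 + C / a)%:E * (g y)%:E)%E.
  rewrite ge0_integralZr//; last 3 first.
  - apply/measurable_EFinP; apply: measurable_funM => //.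
    by apply: measurable_funD.
  - by move=> x _; rewrite lee_fin mulr_ge0//; have := cos_geN1 (a * x + (b * y + c)); lra.
  - by rewrite lee_fin.
  by rewrite lee_wpmul2r ?lee_fin//; exact: HC.
rewrite /borel_lebesgue2; case: sw @f f0 mf mF F0 => f f0 mf mF F0.
- rewrite fubini_tonelli1//; apply: le_trans intg.
  apply: ge0_le_integral => //.
  + by move=> x _; apply: integral_ge0.
  + exact: measurable_fun_fubini_tonelli_F.
  + by apply: emeasurable_funM => //; exact/measurable_EFinP.
  + move=> x _; apply: le_trans (inner x); rewrite /fubini_F le_eqVlt; apply/orP; left; apply/eqP.
    apply: eq_integral => y _; rewrite /f densE /= -!EFinM; congr EFin.
    by rewrite (addrC (b * x)) -addrA; ring.
- rewrite fubini_tonelli2//; apply: le_trans intg.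
  apply: ge0_le_integral => //.
  + by move=> x _; apply: integral_ge0.
  + exact: measurable_fun_fubini_tonelli_G.
  + by apply: emeasurable_funM => //; exact/measurable_EFinP.
  + move=> y _; apply: le_trans (inner y); rewrite /fubini_G le_eqVlt; apply/orP; left; apply/eqP.
    apply: eq_integral => x _; rewrite /f densE /= -!EFinM; congr EFin.
    by rewrite -addrA; ring.
Qed.

Lemma measurable_cos_nu (a b c : R) :
  measurable_fun [set: P] (fun p : P => cos (a * p.1 + b * p.2 + c)).
Proof. exact: (measurable_fun_plane (@measurable_cos_plane a b c)). Qed.

Lemma integrable_cos_nu (a b c : R) :
  nu.-integrable [set: P] (EFin \o (fun p : P => cos (a * p.1 + b * p.2 + c))).
Proof.
apply: (@fin_bounded_integrable _ _ _ (@nu R) _ 1); first exact: measurable_cos_nu.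
by move=> p; rewrite ler_norml cos_geN1 cos_le1.
Qed.

(** As [nu] has total mass exactly 1, the summand 1 cancels from the bound on the integral of 1 +
    cos, and only the term of order 1 / |a| remains. *)
Lemma cos_nu_decay : exists C : R, forall a b c : R,
  let I := \int[nu]_(p in [set: P]) cos (a * p.1 + b * p.2 + c) in
  `|I| * `|a| <= C /\ `|I| * `|b| <= C.
Proof.
have ub sw : exists2 C : R, 0 <= C & forall a b c : R, a != 0 ->
    \int[nu]_(p in [set: P]) cos (if sw then b * p.1 + a * p.2 + c else a * p.1 + b * p.2 + c)
      <= C / `|a|.
  have [C HC] := integral_1cos_nu sw.
  exists `|C| => // a b c a0.
  wlog {a0} a0 : a b c / 0 < a.
    move=> H; have [a_gt0|a_le0] := ltP 0 a; first exact: H.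
    have Na0 : 0 < - a by rewrite oppr_gt0 lt_neqAle a0.
    have := H (- a) (- b) (- c) Na0; rewrite normrN => /(le_trans _); apply.
    rewrite le_eqVlt; apply/orP; left; apply/eqP; apply: eq_Rintegral => p _.
    by rewrite -cosN; congr cos; case: sw {HC H}; ring.
  have icos : nu.-integrable [set: P] (EFin \o (fun p : P =>
      cos (if sw then b * p.1 + a * p.2 + c else a * p.1 + b * p.2 + c))).
    by case: sw {HC}; exact: integrable_cos_nu.
  have := HC a b c a0.
  under eq_integral do rewrite EFinD.
  rewrite integralD//; last first.
    by apply: (@fin_bounded_integrable _ _ _ (@nu R) (cst 1) 1) => // p; rewrite normr1.
  have -> : (\int[nu]_(p in [set: P]) 1%:E = 1)%E.
    by rewrite integral_cst// mul1e; exact: nu_setT.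
  rewrite EFinD leeD2lE//.
  rewrite -[X in (X <= _)%E]fineK; last exact: integrable_fin_num.
  rewrite lee_fin => /le_trans; apply.
  by rewrite (gtr0_norm a0) ler_pM2r ?invr_gt0// ler_norm.
have [C1 C10 H1] := ub false; have [C2 C20 H2] := ub true.
have neg (a b c : R) : - (\int[nu]_(p in [set: P]) cos (a * p.1 + b * p.2 + c)) =
    (\int[nu]_(p in [set: P]) cos (a * p.1 + b * p.2 + (c + pi))).
  rewrite -mulN1r -RintegralZl//; last exact: integrable_cos_nu.
  by apply: eq_Rintegral => p _; rewrite addrA cosDpi mulN1r.
exists (C1 + C2) => a b c; split.
- have [->|a0] := eqVneq a 0; first by rewrite normr0 mulr0 addr_ge0.
  rewrite -ler_pdivlMr ?normr_gt0//; apply: (@le_trans _ _ (C1 / `|a|)).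
    by rewrite ler_norml lerNl neg !(H1 _ _ _ a0).
  by rewrite ler_pM2r ?invr_gt0 ?normr_gt0// lerDl.
- have [->|b0] := eqVneq b 0; first by rewrite normr0 mulr0 addr_ge0.
  rewrite -ler_pdivlMr ?normr_gt0//; apply: (@le_trans _ _ (C2 / `|b|)).
    by rewrite ler_norml lerNl neg !(H2 _ _ _ b0).
  by rewrite ler_pM2r ?invr_gt0 ?normr_gt0// lerDr.
Qed.

End gauss_cos.

(** * Fourier analysis on the completed plane *)

Section plane_fourier.
Context {R : realType}.
Local Notation P := (plane R).
Local Notation RR := (measurableTypeR R * measurableTypeR R)%type.

Let X (p : P) : R := p.1.
Let Y (p : P) : R := p.2.

Let mX : measurable_fun [set: P] X.
Proof. exact: (@measurable_fun_plane _ _ (measurableTypeR R) (fst : RR -> measurableTypeR R)). Qed.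

Let mY : measurable_fun [set: P] Y.
Proof. exact: (@measurable_fun_plane _ _ (measurableTypeR R) (snd : RR -> measurableTypeR R)). Qed.

Lemma nu_le_lambda (A : set P) : measurable A -> (nu A <= lambda A)%E.
Proof.
move=> mA; rewrite -[leRHS]mul1e -integral_cst//.
apply: ge0_le_integral => //.
- by move=> p _; rewrite lee_fin gauss_density_ge0.
- by apply/measurable_EFinP; apply: measurable_funTS; exact: measurable_gauss_density.
- move=> p _; rewrite lee_fin gauss_densityE.
  have h (x : R) : 0 <= gauss_fun x / Num.sqrt pi <= 1.
    rewrite mulr_ge0 ?gauss_fun_ge0 ?invr_ge0//= mulr_ile1 ?gauss_fun_ge0 ?gauss_fun_le1 ?invr_ge0//.
    rewrite invf_le1; last by rewrite sqrtr_gt0 pi_gt0.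
    by rewrite -[leLHS]sqrtr1 ler_sqrt ?pi_gt0//; have := pi_ge2 R; lra.
  have /andP[a0 a1] := h p.1; have /andP[b0 b1] := h p.2.
  by rewrite mulr_ile1.
Qed.

(** A set of finite Lebesgue measure has a Borel superset of nearly the same measure, and the excess
    is no larger for [nu], whose density is at most 1. Finiteness is what allows measures to be
    subtracted; a general set is exhausted by sets of finite measure. *)
Lemma btrigcl_plane (A : set P) : measurable A -> btrigcl (@nu R) X Y (\1_A).
Proof.
have fin (B : set P) : measurable B -> (lambda B < +oo)%E -> btrigcl (@nu R) X Y (\1_B).
  move=> mB Boo; apply: (btrigcl_indic_approx mX mY mB) => e e0.
  have [C [mC BC Ce]] := mu_ext_cover Boo e0.
  have mC' : measurable (C : set P) by exact: measurable_plane.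
  exists C; split => //.
    have := @btrigcl_indic_borel _ _ _ (@nu R) X Y mX mY C mC.
    by rewrite (_ : _ @^-1` C = C :> set P)//; apply/seteqP; split => -[x y].
  apply: (le_trans (nu_le_lambda (measurableD mC' mB))).
  have leC : (lambda (C : set P) <= lambda B + e%:E)%E by rewrite lambdaE.
  have lC : (lambda (C : set P) < +oo)%E.
    by apply: le_lt_trans leC _; rewrite lte_add_pinfty// ltry.
  rewrite measureD// setIidr// leeBlDr ?ge0_fin_numE// addeC; exact: leC.
move=> mA.
have /sigma_finiteP[F [TF ndF Foo]] := @lambda_sigma_finite R.
apply: (@btrigcl_cvg _ _ _ (@nu R) X Y mX mY (fun n => \1_(A `&` F n)) _ 1).
- move=> n; have [mF Fn] := Foo n; apply: fin; first exact: measurableI.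
  by apply: le_lt_trans Fn; apply: le_measure; rewrite ?inE//; exact: measurableI.
- by move=> n p; rewrite indicE; case: (_ \in _); rewrite ?normr1 ?normr0.
- move=> p; apply: cvg_near_cst.
  have [k _ Fkp] : (\bigcup_k F k) p by rewrite -TF.
  near=> n; rewrite !indicE in_setI.
  have Fnp : F n p.
    have kn : (k <= n)%N by near: n; exact: nbhs_infty_ge.
    by move/subsetPset: (ndF _ _ kn); apply.
  by rewrite [p \in F n]mem_set// andbT.
Unshelve. all: by end_near. Qed.

Lemma riemann_lebesgue_plane (f : P -> R) : nu.-integrable setT (EFin \o f) ->
  forall e : R, 0 < e -> exists A : R, forall a b c : R, (A <= `|a|) || (A <= `|b|) ->
    `|\int[nu]_(p in [set: P]) (cos (a * p.1 + b * p.2 + c) * f p)| <= e.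
Proof.
exact: (@riemann_lebesgue _ _ _ (@nu R) X Y mX mY btrigcl_plane (@cos_nu_decay R)).
Qed.

Lemma fourier_unique_plane (f : P -> R) (M : R) : measurable_fun setT f ->
  (forall p, `|f p| <= M) ->
  (forall a b c, \int[nu]_(p in [set: P]) (cos (a * p.1 + b * p.2 + c) * f p) = 0) ->
  {ae @lambda R, forall p, f p = 0}.
Proof.
move=> mf fM f0.
have [N [mN N0 sN]] := @fourier_unique _ _ _ (@nu R) X Y mX mY btrigcl_plane f M mf fM f0.
by exists N; split => //; exact: nu_null.
Qed.

End plane_fourier.

(** * The complex exponential *)

Section complex_exp.
Context {R : realType}.
Implicit Types (z w c : R[i]) (x y t : R).
Local Notation normc := Normc.normc.

Lemma complex_normE z : `|z| = (normc z)%:C.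
Proof. by []. Qed.

Lemma normc_ge0 z : 0 <= normc z.
Proof. by case: z => a b; exact: sqrtr_ge0. Qed.

Lemma normc_eq0 z : (normc z == 0) = (z == 0).
Proof.
by apply/eqP/eqP => [/Normc.eq0_normc//|->]; exact: Normc.normc0.
Qed.

Lemma normc_conj z : normc z^* = normc z.
Proof. by case: z => a b; rewrite /= sqrrN. Qed.

Lemma normc_real x : normc x%:C = `|x|.
Proof. by rewrite /= expr0n addr0 sqrtr_sqr. Qed.

Lemma normcX z n : normc (z ^+ n) = normc z ^+ n.
Proof. by elim: n => [|n IH]; rewrite ?Normc.normc1// !exprS Normc.normcM IH. Qed.

Lemma normr_Re_le z : `|complex.Re z| <= normc z.
Proof.
case: z => a b /=; rewrite -sqrtr_sqr; apply: ler_wsqrtr.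
by rewrite lerDl sqr_ge0.
Qed.

Lemma normr_Im_le z : `|complex.Im z| <= normc z.
Proof.
case: z => a b /=; rewrite -sqrtr_sqr; apply: ler_wsqrtr.
by rewrite lerDr sqr_ge0.
Qed.

Lemma normc_le_ReIm z : normc z <= `|complex.Re z| + `|complex.Im z|.
Proof.
case: z => a b /=; have ab0 : 0 <= `|a| + `|b| by rewrite addr_ge0.
rewrite -(ger0_norm ab0) -sqrtr_sqr; apply: ler_wsqrtr.
rewrite sqrrD !real_normK ?num_real//.
have : 0 <= `|a| * `|b| by rewrite mulr_ge0.
lra.
Qed.

Lemma normc_sum (I : Type) (s : seq I) (P : pred I) (f : I -> R[i]) :
  normc (\sum_(i <- s | P i) f i) <= \sum_(i <- s | P i) normc (f i).
Proof.
elim/big_ind2: _ => [|x1 x2 y1 y2 h1 h2|//]; first by rewrite Normc.normc0.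
by rewrite (le_trans (le_normcD _ _))// lerD.
Qed.

Lemma normc_prod (I : Type) (s : seq I) (P : pred I) (f : I -> R[i]) :
  normc (\prod_(i <- s | P i) f i) = \prod_(i <- s | P i) normc (f i).
Proof.
by elim/big_ind2: _ => [|x1 x2 y1 y2 <- <-|//]; rewrite ?Normc.normc1// Normc.normcM.
Qed.

Definition cexp z : R[i] :=
  (expR (complex.Re z) * cos (complex.Im z)) +i* (expR (complex.Re z) * sin (complex.Im z)).

Lemma cexpD z w : cexp (z + w) = cexp z * cexp w.
Proof.
case: z w => a b [c d]; rewrite /cexp /= expRD cosD sinD.
by apply/eqP; rewrite eq_complex /=; apply/andP; split; apply/eqP; ring.
Qed.

Lemma cexp0 : cexp 0 = 1.
Proof. by rewrite /cexp /= expR0 cos0 sin0 mulr1 mulr0. Qed.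

Lemma normc_cexp z : normc (cexp z) = expR (complex.Re z).
Proof.
rewrite /= !exprMn -mulrDr cos2Dsin2 mulr1 sqrtr_sqr ger0_norm ?expR_ge0//.
Qed.

Lemma cexp_conj z : cexp z^* = (cexp z)^*.
Proof. by case: z => a b; rewrite /cexp /= cosN sinN mulrN. Qed.

Definition cexps n z : R[i] := \sum_(k < n) z ^+ k / k`!%:R.

Let ReD z w : complex.Re (z + w) = complex.Re z + complex.Re w.
Proof. by case: z w => ? ? []. Qed.

Let ReB z w : complex.Re (z - w) = complex.Re z - complex.Re w.
Proof. by case: z w => ? ? []. Qed.

Let ReM_real z x : complex.Re (z * x%:C) = complex.Re z * x.
Proof. by case: z => a b /=; ring. Qed.

Let Re_sum (I : Type) (s : seq I) (f : I -> R[i]) :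
  complex.Re (\sum_(i <- s) f i) = \sum_(i <- s) complex.Re (f i).
Proof. by elim/big_ind2: _ => [//|x1 x2 y1 y2 <- <-|//]; rewrite ReD. Qed.

(** On the ray t |-> t z, real parts of c times Taylor polynomials are real polynomials in t, so the
    remainder can be estimated by one-variable monotonicity. *)
Let ray_poly c z n : {poly R} := \poly_(k < n) complex.Re (c * (z ^+ k / k`!%:R)).

Let ray_polyE c z n t : complex.Re (c * cexps n (z * t%:C)) = (ray_poly c z n).[t].
Proof.
rewrite horner_poly /cexps mulr_sumr Re_sum; apply: eq_bigr => k _.
by rewrite -ReM_real rmorphXn /= exprMn; congr complex.Re; ring.
Qed.

Let ray_poly_deriv c z n : (ray_poly c z n.+1)^`() = ray_poly (c * z) z n.
Proof.
apply/polyP => k; rewrite coef_deriv !coef_poly ltnS; case: ifP => kn; last by rewrite mul0rn.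
rewrite -[LHS]mulr_natr -ReM_real; congr complex.Re.
rewrite rmorph_nat factS natrM exprS.
have k1 : (k.+1%:R : R[i]) != 0 by rewrite pnatr_eq0.
have k2 : (k`!%:R : R[i]) != 0 by rewrite pnatr_eq0 -lt0n fact_gt0.
move: (k.+1%:R : R[i]) (k`!%:R : R[i]) k1 k2 => u v u0 v0; field.
by rewrite u0 v0.
Qed.

Let is_derive_ray c z (t : R) : is_derive t (1 : R)
  (fun t : R => complex.Re (c * cexp (z * t%:C)) : R) (complex.Re (c * z * cexp (z * t%:C))).
Proof.
case: c z => a b [x y] /=.
have h1 : is_derive t (1 : R) (fun t : R => x * t - y * 0 : R) x.
  by apply: is_derive_eq; rewrite /= /GRing.scale /=; ring.
have h2 : is_derive t (1 : R) (fun t : R => x * 0 + y * t : R) y.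
  by apply: is_derive_eq; rewrite /= /GRing.scale /=; ring.
have e := is_derive1_comp (is_derive_expR _) h1.
have co := is_derive1_comp (is_derive_cos _) h2.
have si := is_derive1_comp (is_derive_sin _) h2.
apply: (@is_derive_eq _ _ _ (fun t =>
  a * ((expR \o (fun t : R => x * t - y * 0)) t *
       (cos \o (fun t : R => x * 0 + y * t)) t) -
  b * ((expR \o (fun t : R => x * t - y * 0)) t *
       (sin \o (fun t : R => x * 0 + y * t)) t))).
by rewrite /= /GRing.scale /=; ring.
Qed.

(* The remainders r_n satisfy r_{n+1}' = z r_n along the ray t |-> t z. *)
Lemma cexp_tail (L : R) n z : 1 <= L ->
  normc (cexp z - cexps n z) <= L^-1 ^+ n * expR (L * normc z).
Proof.
move=> L1; have L0 : 0 < L by lra.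
(* Bounding the real parts of all rotations bounds the modulus: for w nonzero, c = conj(w) / |w|
   gives c w = |w|. *)
suff re_le : forall c z, normc c <= 1 ->
    complex.Re (c * (cexp z - cexps n z)) <= L^-1 ^+ n * expR (L * normc z).
  set w := cexp z - cexps n z.
  have [->|w0] := eqVneq w 0.
    by rewrite Normc.normc0 mulr_ge0 ?expR_ge0// exprn_ge0// invr_ge0 ltW.
  have nw0 : normc w != 0 by rewrite normc_eq0.
  have := re_le (w^* * ((normc w)^-1)%:C) z.
  rewrite -/w Normc.normcM normc_conj normc_real normfV ger0_norm ?normc_ge0// divff// lexx.
  move=> /(_ isT) /(le_trans _); apply.
  rewrite mulrAC ReM_real mulrC -/w.
  have -> : complex.Re (w^* * w) = normc w ^+ 2.
    case: (w) => a b /=; rewrite sqr_sqrtr ?addr_ge0 ?sqr_ge0//; ring.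
  by rewrite expr2 mulrA mulVf// mul1r.
elim: n => [|n IH] c {}z c1.
  rewrite /cexps big_ord0 subr0 expr0 mul1r.
  apply: le_trans (ler_norm _) _; apply: le_trans (normr_Re_le _) _.
  rewrite Normc.normcM normc_cexp; apply: le_trans (ler_piMl (expR_ge0 _) c1) _.
  rewrite ler_expR; apply: le_trans (ler_norm _) _; apply: le_trans (normr_Re_le _) _.
  by rewrite ler_peMl ?normc_ge0.
(* f is the remainder on the ray and g the claimed bound. The induction hypothesis with c z / |z| as
   coefficient gives f' <= g', so g - f is nondecreasing on [0, 1], with f(0) = 0 <= g(0). *)
pose f t := complex.Re (c * cexp (z * t%:C)) - (ray_poly c z n.+1).[t].
pose g t := L^-1 ^+ n.+1 * expR (L * normc z * t).
pose f' t := complex.Re (c * z * cexp (z * t%:C)) - (ray_poly (c * z) z n).[t].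
pose g' t := L^-1 ^+ n * normc z * expR (L * normc z * t).
have df t : is_derive t (1 : R) (f : R -> R) (f' t).
  apply: is_deriveB; first exact: is_derive_ray.
  rewrite -ray_poly_deriv derivE derive1E.
  exact: (DeriveDef (@derivable_horner R (ray_poly c z n.+1) t) erefl).
have dg t : is_derive t (1 : R) (g : R -> R) (g' t).
  have h : is_derive t (1 : R) (fun t : R => L * normc z * t : R) (L * normc z).
    by apply: is_derive_eq; rewrite /= /GRing.scale /=; ring.
  have e := is_derive1_comp (is_derive_expR _) h.
  apply: (@is_derive_eq _ _ _ (fun t => L^-1 ^+ n.+1 * (expR \o (fun t => L * normc z * t)) t)).
  rewrite /g' /= /GRing.scale /= exprS; field.
  by rewrite gt_eqF.
have dgf t : is_derive t (1 : R) (g - f : R -> R) (g' t - f' t) by apply: is_deriveB.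
have f'g' t : 0 <= t -> f' t <= g' t.
  move=> t0; rewrite /f' /g' -ray_polyE -ReB -mulrBr.
  have [z0|z0] := eqVneq z 0.
    by rewrite z0 !mulr0 mul0r Normc.normc0 mulr0 mul0r.
  have nz0 : 0 < normc z by rewrite lt_neqAle normc_ge0 eq_sym normc_eq0 z0.
  have := IH (c * z * ((normc z)^-1)%:C) (z * t%:C).
  rewrite !Normc.normcM !normc_real normfV (gtr0_norm nz0) mulfK ?gt_eqF// => /(_ c1).
  rewrite mulrAC ReM_real (ger0_norm t0) ler_pdivrMr// => /le_trans; apply.
  by rewrite /g' mulrA [leLHS]mulrAC.
have := @ger0_derive1_le_cc R (g - f) 0 1.
have -> : complex.Re (c * (cexp z - cexps n.+1 z)) = f 1.
  by rewrite /f -ray_polyE mulr1 mulrBr ReB.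
have -> : L^-1 ^+ n.+1 * expR (L * normc z) = g 1 by rewrite /g mulr1.
move=> H; have : (g - f) 0 <= (g - f) 1.
  apply: H; rewrite ?in_itv/= ?lexx ?ler01//.
  - move=> t; rewrite in_itv /= => /andP[t0 _]; rewrite derive1E.
    by have [_ ->] := dgf t; rewrite subr_ge0 f'g'// ltW.
  - apply: derivable_within_continuous => t _.
    by have [] := dgf t.
rewrite /= fctE /= => {}H; rewrite -subr_ge0; apply: le_trans H; rewrite subr_ge0.
have -> : f 0 = 0.
  rewrite /f -ray_polyE mulr0 cexp0 /cexps big_ord_recl big1 ?addr0; last first.
    by move=> i _; rewrite expr0n /= mul0r.
  by rewrite expr0 divr1 subrr.
by rewrite /g mulr_ge0 ?expR_ge0// exprn_ge0// invr_ge0 ltW.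
Qed.

(** The second-order remainder bound comes from [cexp_tail] with L = 1 / |h|: L^-2 is then |h|^2,
    and the exponential factor is the constant e. *)
Lemma cexp_derivable w (z : R[i]) : derivable ((fun z => cexp (z * w)) : R[i]^o -> R[i]^o) z 1.
Proof.
have quad h : normc h <= 1 -> normc (cexp h - 1 - h) <= normc h ^+ 2 * expR 1.
  have [->|h0] := eqVneq h 0.
    by rewrite cexp0 subrr subr0 Normc.normc0 expr0n mul0r.
  have nh0 : 0 < normc h by rewrite lt_neqAle normc_ge0 eq_sym normc_eq0 h0.
  move=> h1; have L1 : 1 <= (normc h)^-1 by rewrite invf_ge1.
  have := cexp_tail 2 h L1.
  rewrite invrK mulVf ?gt_eqF// /cexps !big_ord_recl big_ord0 /= addr0.
  by rewrite expr0 fact0 divr1 /= expr1 divr1 opprD addrA.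
apply/cvg_ex; exists (cexp (z * w) * w).
apply/cvgrPdist_le => e e0.
have [e' -> e'0] : exists2 e' : R, e = e'%:C & 0 < e'.
  move: e0; case: (e) => a b; rewrite ltcE /= => /andP[/eqP -> a0].
  by exists a.
pose C := normc (cexp (z * w)) * (normc w ^+ 2 * expR 1).
have C0 : 0 <= C by rewrite mulr_ge0 ?normc_ge0// mulr_ge0 ?expR_ge0// sqr_ge0.
(* The first bound keeps |h w| below 1, where the quadratic estimate holds; the second makes C |h|
   at most e'. *)
pose dl := Num.min (normc w + 1)^-1 (e' / (C + 1)).
have dl0 : 0 < dl by rewrite lt_min invr_gt0 ltr_wpDl ?normc_ge0//= divr_gt0//; lra.
near=> h.
have h0 : h != 0 by near: h; exact: nbhs_dnbhs_neq.
have : `|h| <= dl%:C.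
  near: h; apply: dnbhs0_le; by rewrite ltcR.
rewrite complex_normE lecR le_min => /andP[h1 h2].
have nh0 : 0 < normc h by rewrite lt_neqAle normc_ge0 eq_sym normc_eq0 h0.
rewrite complex_normE lecR /GRing.scale /= mulr1.
have -> : cexp (z * w) * w - h^-1 * (cexp ((h + z) * w) - cexp (z * w)) =
  - (cexp (z * w) * (cexp (h * w) - 1 - h * w) * h^-1).
  by rewrite mulrDl cexpD; field.
rewrite normcN !Normc.normcM Normc.normcV ler_pdivrMr//.
have hw1 : normc (h * w) <= 1.
  rewrite Normc.normcM; apply: (@le_trans _ _ ((normc w + 1)^-1 * normc w)).
    by rewrite ler_wpM2r ?normc_ge0.
  by rewrite mulrC ler_pdivrMr ?mul1r ?lerDl// ltr_wpDl ?normc_ge0.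
apply: le_trans (ler_wpM2l (normc_ge0 _) (quad _ hw1)) _.
rewrite Normc.normcM exprMn.
rewrite [leLHS](_ : _ = C * normc h * normc h); last by rewrite /C; ring.
rewrite ler_wpM2r ?normc_ge0//.
apply: le_trans (ler_wpM2l C0 h2) _.
by rewrite mulrCA ler_piMr ?(ltW e'0)// ler_pdivrMr//; lra.
Unshelve. all: by end_near. Qed.

End complex_exp.

(** * Minors of finite rank kernels and Liouville's theorem *)

Section kernel_minors.
Variables (K : fieldType) (T : Type) (k : T -> T -> K).

Definition kmx m n (a : 'I_m -> T) (b : 'I_n -> T) : 'M[K]_(m, n) :=
  \matrix_(i, j) k (a i) (b j).

(** A matrix of values of k factors through dimension N, so nonzero minors have size at most N; the
    empty minor equals 1, so a largest size exists. *)
Lemma max_minor N (A B : 'I_N -> T -> K) :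
  (forall z w, k z w = \sum_(j < N) A j z * B j w) ->
  exists r (a b : 'I_r -> T), \det (kmx a b) != 0 /\
    forall a' b' : 'I_(r + 1) -> T, \det (kmx a' b') = 0.
Proof.
move=> kE.
pose p r := `[< exists a b : 'I_r -> T, \det (kmx a b) != 0 >].
have ex_p : exists r, p r.
  have e : 'I_0 -> T by case.
  by exists 0%N; apply/asboolP; exists e, e; rewrite det_mx00 oner_neq0.
have p_le r : p r -> (r <= N)%N.
  move=> /asboolP[a [b ab]].
  have E : kmx a b = (\matrix_(i, j) A j (a i)) *m (\matrix_(j, i) B j (b i)).
    by apply/matrixP => i j; rewrite !mxE kE; apply: eq_bigr => l _; rewrite !mxE.
  have : kmx a b \in unitmx by rewrite unitmxE unitfE.
  rewrite -row_full_unit => /eqP <-; rewrite E.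
  exact: leq_trans (mxrankM_maxr _ _) (rank_leq_row _).
case: (ex_maxnP ex_p p_le) => r /asboolP[a [b ab]] rmax.
exists r, a, b; split => // a' b'; apply/eqP/negP => /negP det_n0.
suff : (r + 1 <= r)%N by rewrite addn1 ltnn.
by apply: rmax; apply/asboolP; exists a', b'.
Qed.

Variables (r : nat) (a b : 'I_r -> T).
Hypothesis ab : \det (kmx a b) != 0.
Hypothesis maxr : forall a' b' : 'I_(r + 1) -> T, \det (kmx a' b') = 0.

(** Bordering the maximal minor by the row of s_i and the column of t_j gives a vanishing
    determinant. It is det([kmx a b]) times the Schur complement, which is therefore 0, and this is
    the claimed entry. *)
Lemma minor_factor m n (s : 'I_m -> T) (t : 'I_n -> T) :
  kmx s t = kmx s b *m invmx (kmx a b) *m kmx a t.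
Proof.
have uM : kmx a b \in unitmx by rewrite unitmxE unitfE.
apply/matrixP => i j.
pose ext (u : 'I_r -> T) (z : T) (l : 'I_(r + 1)) :=
  match fintype.split l with inl l' => u l' | inr _ => z end.
pose u := kmx a (fun _ : 'I_1 => t j); pose v := kmx (fun _ : 'I_1 => s i) b.
pose d := kmx (fun _ : 'I_1 => s i) (fun _ : 'I_1 => t j).
have blockE : kmx (ext a (s i)) (ext b (t j)) = block_mx (kmx a b) u v d.
  apply/matrixP => x y; rewrite !mxE /ext.
  by case: (fintype.split x) => x'; rewrite !mxE; case: (fintype.split y) => y'; rewrite !mxE.
have := maxr (ext a (s i)) (ext b (t j)); rewrite blockE.
have -> : block_mx (kmx a b) u v d =
    block_mx 1%:M 0 (v *m invmx (kmx a b)) 1%:M *m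
    block_mx (kmx a b) u 0 (d - v *m invmx (kmx a b) *m u).
  rewrite mulmx_block !mul1mx !mul0mx !addr0 mulmxKV//.
  by rewrite addrC subrK.
rewrite det_mulmx det_lblock det_ublock !det1 !mul1r => /eqP.
rewrite mulf_eq0 (negbTE ab) /= det_mx11 => /eqP.
rewrite !mxE => /eqP; rewrite subr_eq0 => /eqP ->.
apply: eq_bigr => l _; rewrite !mxE; congr (_ * _).
by apply: eq_bigr => l' _; rewrite !mxE.
Qed.

Lemma det_minor_factor (s t : 'I_r -> T) :
  \det (kmx s t) * \det (kmx a b) = \det (kmx s b) * \det (kmx a t).
Proof.
by rewrite (minor_factor s t) !det_mulmx det_inv; field.
Qed.

End kernel_minors.

(** * Liouville's theorem by averaging over roots of unity *)

Section liouville.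
Context {R : realType}.
Local Notation normc := Normc.normc.
Implicit Types (x z w : R[i]) (phi psi : R[i] -> R[i]).

Lemma cexpX z n : cexp z ^+ n = cexp (z *+ n).
Proof. by elim: n => [|n IH]; rewrite ?cexp0// exprS mulrS cexpD IH. Qed.

(** The root is primitive: its j-th power has angle 2 t with 0 < t < pi, and cos(2 t) = 1 would
    force sin t = 0. *)
Lemma unit_root n : (0 < n)%N -> exists w : R[i],
  [/\ normc w = 1, w ^+ n = 1 & forall j, (0 < j < n)%N -> w ^+ j != 1].
Proof.
move=> n0; have nr0 : 0 < (n%:R : R) by rewrite ltr0n.
pose th : R[i] := 0 +i* (pi *+ 2 / n%:R).
have wX j : cexp th ^+ j = cexp ((0 : R) +i* ((pi * (j%:R / n%:R)) *+ 2)).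
  rewrite cexpX /th; congr cexp; elim: j => [|j IH].
    by rewrite mulr0n mul0r mulr0 mul0rn.
  rewrite mulrS IH; apply/eqP; rewrite eq_complex /= addr0 eqxx /=; apply/eqP.
  by rewrite -[j.+1]addn1 natrD; ring.
exists (cexp th); split.
- by rewrite normc_cexp expR0.
- by rewrite wX divff ?gt_eqF// mulr1 /cexp /= expR0 cos2pi sin2pi mulr1 mulr0.
- move=> j /andP[j0 jn]; rewrite wX; apply/negP => /eqP[].
  rewrite expR0 mul1r => cos1 _.
  have t01 : 0 < (pi : R) * (j%:R / n%:R) < pi.
    rewrite mulr_gt0 ?pi_gt0 ?divr_gt0 ?ltr0n//=.
    by rewrite -[ltRHS]mulr1 ltr_pM2l ?pi_gt0// ltr_pdivrMr// mul1r ltr_nat.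
  have := sin_gt0_pi t01; move: cos1; rewrite cos_mulr2n => cos1.
  have := cos2Dsin2 (pi * (j%:R / n%:R) : R) => cs1 s0.
  have : 0 < sin ((pi : R) * (j%:R / n%:R)) ^+ 2 by rewrite exprn_gt0.
  by move: cs1 cos1; set A := cos _ ^+ 2; set B := sin _ ^+ 2; lra.
Qed.

(** A discrete mean value property, standing in for Cauchy's formula: below degree n every
    nonconstant monomial averages to a vanishing geometric sum. *)
Lemma unit_root_mean n w (p : {poly R[i]}) z : (0 < n)%N -> w ^+ n = 1 ->
  (forall j, (0 < j < n)%N -> w ^+ j != 1) -> (size p <= n)%N ->
  \sum_(i < n) p.[z * w ^+ i] = n%:R * p.[0].
Proof.
move=> n0 wn wj pn.
rewrite horner_coef0.
under eq_bigr do rewrite (horner_coef_wide _ pn).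
rewrite exchange_big /= (bigD1 (Ordinal n0)) //= [X in _ + X]big1 ?addr0.
  under eq_bigr do rewrite expr0 mulr1.
  by rewrite sumr_const card_ord mulr_natl.
move=> j j0; rewrite -mulr_sumr.
under eq_bigr do rewrite exprMn exprAC.
rewrite -mulr_sumr.
suff -> : \sum_(i < n) (w ^+ j) ^+ i = 0 by rewrite !mulr0.
have wj1 : w ^+ j != 1 by apply: wj; rewrite ltn_ord andbT lt0n.
apply/eqP; have := subrX1 (w ^+ j) n.
rewrite exprAC wn expr1n subrr => /esym/eqP.
by rewrite mulf_eq0 subr_eq0 (negbTE wj1).
Qed.

Definition papprox phi := forall r e : R, 0 < e ->
  exists p : {poly R[i]}, forall x, normc x <= r -> normc (phi x - p.[x]) <= e.

Lemma liouville0 phi : papprox phi ->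
  (forall e : R, 0 < e -> exists r : R, forall x, r <= normc x -> normc (phi x) <= e) ->
  phi 0 = 0.
Proof.
move=> phia phi0; apply/eqP; rewrite -normc_eq0 eq_le normc_ge0 andbT.
apply/ler_addgt0Pr => e e0; rewrite add0r.
(* Three errors add up: approximation at 0, approximation on the circle, and the size of [phi] on
   the circle. *)
have e3 : 0 < e / 3 by rewrite divr_gt0.
have [r0 Hr0] := phi0 _ e3.
pose r := Num.max r0 0.
have [p Hp] := phia r _ e3.
have [w [w1 wn wj]] := unit_root (ltn0Sn (size p)); set n := (size p).+1 in wn wj.
have nr0 : (n%:R : R) != 0 by rewrite pnatr_eq0.
have nC0 : (n%:R : R[i]) != 0 by rewrite pnatr_eq0.
have nw i : normc (r%:C * w ^+ i) = r.
  rewrite Normc.normcM normc_real ger0_norm ?le_max ?lexx ?orbT//.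
  by rewrite normcX w1 expr1n mulr1.
have mean := unit_root_mean r%:C (ltn0Sn _) wn wj (leqnSn _).
have pn : normc p.[0] <= e / 3 + e / 3.
  have -> : p.[0] = n%:R^-1 * \sum_(i < n) p.[r%:C * w ^+ i] by rewrite mean mulKf.
  rewrite Normc.normcM Normc.normcV -(rmorph_nat (real_complex R)) normc_real ger0_norm//.
  rewrite ler_pdivrMl ?ltr0n//.
  apply: le_trans (normc_sum _ _ _) _.
  apply: (@le_trans _ _ (\sum_(i < n) (e / 3 + e / 3))); last first.
    by rewrite sumr_const card_ord mulr_natl.
  apply: ler_sum => i _.
  rewrite -[X in normc X](subrK (phi (r%:C * w ^+ i))).
  apply: le_trans (le_normcD _ _) _; apply: lerD.
    by rewrite -normcN opprB; apply: Hp; rewrite nw.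
  by apply: Hr0; rewrite nw le_max lexx.
rewrite -[X in normc X](subrK p.[0]).
apply: le_trans (le_normcD _ _) _.
have := Hp 0; rewrite Normc.normc0 le_max lexx orbT => /(_ isT).
lra.
Qed.

Lemma poly_disc_bound (p : {poly R[i]}) (r : R) :
  exists B : R, forall x, normc x <= r -> normc p.[x] <= B.
Proof.
exists (\sum_(i < size p) normc p`_i * r ^+ i) => x xr.
rewrite horner_coef; apply: le_trans (normc_sum _ _ _) _.
apply: ler_sum => i _; rewrite Normc.normcM normcX ler_wpM2l ?normc_ge0//.
by apply: lerXn2r => //; rewrite ?nnegrE ?normc_ge0//; exact: le_trans (normc_ge0 _) xr.
Qed.

Lemma papprox_bound phi (r : R) : papprox phi ->
  exists2 B : R, 0 <= B & forall x, normc x <= r -> normc (phi x) <= B.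
Proof.
move=> /(_ r 1 ltr01)[p Hp]; have [B HB] := poly_disc_bound p r.
exists (`|B| + 1); first by rewrite addr_ge0.
move=> x xr; rewrite -[X in normc X](subrK p.[x]) addrC.
apply: le_trans (le_normcD _ _) _; apply: lerD; last exact: Hp.
exact: le_trans (HB _ xr) (ler_norm _).
Qed.

Lemma papprox_cst c : papprox (fun _ => c).
Proof.
by move=> r e e0; exists c%:P => x _; rewrite hornerC subrr Normc.normc0 ltW.
Qed.

Lemma papproxD phi psi : papprox phi -> papprox psi -> papprox (fun x => phi x + psi x).
Proof.
move=> H1 H2 r e e0; have e20 : 0 < e / 2 by rewrite divr_gt0.
have [p Hp] := H1 r _ e20; have [q Hq] := H2 r _ e20.
exists (p + q) => x xr; rewrite hornerD opprD addrACA.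
by apply: le_trans (le_normcD _ _) _; rewrite [leRHS]splitr lerD ?Hp ?Hq.
Qed.

Lemma papproxM phi psi : papprox phi -> papprox psi -> papprox (fun x => phi x * psi x).
Proof.
move=> H1 H2 r e e0.
have [B1 B10 HB1] := papprox_bound r H1; have [B2 B20 HB2] := papprox_bound r H2.
have e20 : 0 < e / 2 by rewrite divr_gt0.
(* The minimum with 1 keeps the approximant q of psi bounded by [B2] + 1, the bound that [d1] relies
   on. *)
pose d1 := e / 2 / (B2 + 1); pose d2 := Num.min 1 (e / 2 / (B1 + 1)).
have d10 : 0 < d1 by rewrite /d1 !divr_gt0//; lra.
have d20 : 0 < d2 by rewrite lt_min ltr01 !divr_gt0//; lra.
have [p Hp] := H1 r _ d10; have [q Hq] := H2 r _ d20.
exists (p * q) => x xr; rewrite hornerM.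
have -> : phi x * psi x - p.[x] * q.[x] = phi x * (psi x - q.[x]) + (phi x - p.[x]) * q.[x] by ring.
apply: le_trans (le_normcD _ _) _; rewrite !Normc.normcM.
have h1 := HB1 _ xr; have h2 := Hp _ xr; have := Hq _ xr.
rewrite le_min => /andP[h3 h4].
have h5 : normc q.[x] <= B2 + 1.
  rewrite -[X in normc X](subrK (psi x)) addrC; apply: le_trans (le_normcD _ _) _.
  by rewrite lerD// ?HB2// -normcN opprB.
rewrite [leRHS]splitr lerD//.
  apply: (@le_trans _ _ (B1 * (e / 2 / (B1 + 1)))); first by rewrite ler_pM ?normc_ge0.
  by rewrite mulrCA ler_piMr ?(ltW e20)// ler_pdivrMr//; lra.
apply: (@le_trans _ _ (d1 * (B2 + 1))); first by rewrite ler_pM ?normc_ge0.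
by rewrite /d1 divfK// gt_eqF//; lra.
Qed.

Lemma papprox_sum (I : finType) (f : I -> R[i] -> R[i]) :
  (forall i, papprox (f i)) -> papprox (fun x => \sum_i f i x).
Proof.
move=> H; elim: (index_enum I) => [|i s IH].
  under eq_fun do rewrite big_nil.
  exact: papprox_cst.
under eq_fun do rewrite big_cons.
exact: papproxD.
Qed.

Lemma papprox_prod (I : finType) (f : I -> R[i] -> R[i]) :
  (forall i, papprox (f i)) -> papprox (fun x => \prod_i f i x).
Proof.
move=> H; elim: (index_enum I) => [|i s IH].
  under eq_fun do rewrite big_nil.
  exact: papprox_cst.
under eq_fun do rewrite big_cons.
exact: papproxM.
Qed.

Lemma papprox_det n (f : 'I_n -> 'I_n -> R[i] -> R[i]) :
  (forall i j, papprox (f i j)) -> papprox (fun x => \det (\matrix_(i, j) f i j x)).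
Proof.
move=> H; apply: papprox_sum => s; apply: papproxM; first exact: papprox_cst.
under eq_fun do under eq_bigr do rewrite mxE.
by apply: papprox_prod => i.
Qed.

(** Each of the (n + 1)! products in the Leibniz formula has one factor bounded by e and all others
    by 1. The size must be positive: the empty determinant is 1 and does not decay. *)
Lemma normc_det_le n (M : 'M[R[i]]_n.+1) (e : R) : e <= 1 ->
  (forall i j, normc (M i j) <= e) -> normc (\det M) <= n.+1`!%:R * e.
Proof.
move=> e1 Me; apply: le_trans (normc_sum _ _ _) _.
apply: (@le_trans _ _ (\sum_(s : 'S_n.+1) e)); last first.
  by rewrite sumr_const card_Sn mulr_natl.
apply: ler_sum => s _; rewrite Normc.normcM normcX normcN Normc.normc1 expr1n mul1r.
rewrite normc_prod big_ord_recl /= -[leRHS]mulr1.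
apply: ler_pM => //; first exact: normc_ge0.
  by apply: prodr_ge0 => i _; exact: normc_ge0.
apply: prodr_ile1 => i _; rewrite normc_ge0/=; exact: le_trans (Me _ _) e1.
Qed.

End liouville.

(** * Complex-valued integrals and exponential kernels *)

Section complex_integral.
Context {R : realType} {d : measure_display} {P : measurableType d}.
Variable mu : {measure set P -> \bar R}.
Local Notation normc := Normc.normc.
Local Notation Re := complex.Re.
Local Notation Im := complex.Im.
Implicit Types (f g : P -> R[i]) (h : P -> R).

Definition cmeas f := measurable_fun setT (fun p => Re (f p)) /\
  measurable_fun setT (fun p => Im (f p)).

Definition cint f : R[i] := (\int[mu]_p Re (f p)) +i* (\int[mu]_p Im (f p)).

Definition cinteg f := mu.-integrable setT (fun p => (Re (f p))%:E) /\
  mu.-integrable setT (fun p => (Im (f p))%:E).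

Lemma eq_ReIm (z w : R[i]) : Re z = Re w -> Im z = Im w -> z = w.
Proof. by case: z w => a b [c e] /= -> ->. Qed.

Lemma Re_mulc (z w : R[i]) : Re (z * w) = Re z * Re w - Im z * Im w.
Proof. by case: z w => a b [c e]. Qed.

Lemma Im_mulc (z w : R[i]) : Im (z * w) = Re z * Im w + Im z * Re w.
Proof. by case: z w => a b [c e] /=; rewrite addrC mulrC. Qed.

Lemma Re_addc (z w : R[i]) : Re (z + w) = Re z + Re w.
Proof. by case: z w => a b []. Qed.

Lemma Im_addc (z w : R[i]) : Im (z + w) = Im z + Im w.
Proof. by case: z w => a b []. Qed.

Lemma Re_oppc (z : R[i]) : Re (- z) = - Re z.
Proof. by case: z. Qed.

Lemma Im_oppc (z : R[i]) : Im (- z) = - Im z.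
Proof. by case: z. Qed.

Lemma Re_conjc (z : R[i]) : Re z^* = Re z.
Proof. by case: z. Qed.

Lemma Im_conjc (z : R[i]) : Im z^* = - Im z.
Proof. by case: z. Qed.

Lemma cmeas_cst z : cmeas (fun _ => z).
Proof. by split. Qed.

Lemma cmeasM f g : cmeas f -> cmeas g -> cmeas (fun p => f p * g p).
Proof.
move=> [rf imf] [rg ig]; split.
  under eq_fun do rewrite Re_mulc.
  by apply: measurable_funB; apply: measurable_funM.
under eq_fun do rewrite Im_mulc.
by apply: measurable_funD; apply: measurable_funM.
Qed.

Lemma cmeasD f g : cmeas f -> cmeas g -> cmeas (fun p => f p + g p).
Proof.
move=> [rf imf] [rg ig]; split.
  under eq_fun do rewrite Re_addc.
  exact: measurable_funD.
under eq_fun do rewrite Im_addc.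
exact: measurable_funD.
Qed.

Lemma cmeasN f : cmeas f -> cmeas (fun p => - f p).
Proof.
move=> [rf imf]; split.
  under eq_fun do rewrite Re_oppc.
  exact: measurableT_comp.
under eq_fun do rewrite Im_oppc.
exact: measurableT_comp.
Qed.

Lemma cmeasJ f : cmeas f -> cmeas (fun p => (f p)^*).
Proof.
move=> [rf imf]; split.
  by under eq_fun do rewrite Re_conjc.
under eq_fun do rewrite Im_conjc.
exact: measurableT_comp.
Qed.

Lemma cmeasX f n : cmeas f -> cmeas (fun p => f p ^+ n).
Proof.
move=> mf; elim: n => [|n IH]; first exact: cmeas_cst.
under eq_fun do rewrite exprS.
exact: cmeasM.
Qed.

Lemma cmeas_exp f : cmeas f -> cmeas (fun p => cexp (f p)).
Proof.
move=> [rf imf]; split; apply: measurable_funM.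
- exact: measurableT_comp.
- apply: measurableT_comp => //.
  by apply: continuous_measurable_fun; exact: continuous_cos.
- exact: measurableT_comp.
- apply: measurableT_comp => //.
  by apply: continuous_measurable_fun; exact: continuous_sin.
Qed.

Lemma measurable_normc2 f : cmeas f -> measurable_fun setT (fun p => normc (f p) ^+ 2).
Proof.
move=> [rf imf].
have -> : (fun p => normc (f p) ^+ 2) = (fun p => Re (f p) ^+ 2 + Im (f p) ^+ 2).
  apply/funext => p; case: (f p) => a b /=.
  by rewrite sqr_sqrtr// addr_ge0 ?sqr_ge0.
by apply: measurable_funD; apply: measurable_funX.
Qed.

Lemma measurable_normc f : cmeas f -> measurable_fun setT (fun p => normc (f p)).
Proof.
move=> mf.
have -> : (fun p => normc (f p)) = (fun p => Num.sqrt (normc (f p) ^+ 2)).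
  by apply/funext => p; rewrite sqrtr_sqr ger0_norm ?normc_ge0.
apply: measurableT_comp; last exact: measurable_normc2.
by apply: continuous_measurable_fun; exact: sqrt_continuous.
Qed.

Lemma cinteg_dom f h : cmeas f -> mu.-integrable setT (fun p => (h p)%:E) ->
  (forall p, normc (f p) <= h p) -> cinteg f.
Proof.
move=> [rf imf] ih fh; split; apply: le_integrable ih => //.
- exact/measurable_EFinP.
- move=> p _; rewrite lee_fin; apply: le_trans (normr_Re_le _) _.
  exact: le_trans (fh p) (ler_norm _).
- exact/measurable_EFinP.
- move=> p _; rewrite lee_fin; apply: le_trans (normr_Im_le _) _.
  exact: le_trans (fh p) (ler_norm _).
Qed.

(** The factor 2 comes from estimating real and imaginary parts separately; it is harmless for
    convergence. *)
Lemma normc_cint_le f h : cinteg f -> mu.-integrable setT (fun p => (h p)%:E) ->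
  (forall p, normc (f p) <= h p) -> normc (cint f) <= 2 * \int[mu]_p h p.
Proof.
move=> [rf imf] ih fh; apply: le_trans (normc_le_ReIm _) _ => /=.
rewrite mulr_natl mulr2n; apply: lerD.
  apply: le_trans (le_normr_Rintegral measurableT rf) _.
  apply: le_Rintegral => //; first exact: (integrable_abse rf).
  by move=> p _; apply: le_trans (normr_Re_le _) _.
apply: le_trans (le_normr_Rintegral measurableT imf) _.
apply: le_Rintegral => //; first exact: (integrable_abse imf).
by move=> p _; apply: le_trans (normr_Im_le _) _.
Qed.

Lemma cintegD f g : cinteg f -> cinteg g -> cinteg (fun p => f p + g p).
Proof.
move=> [rf imf] [rg ig]; split.
  under eq_fun do rewrite Re_addc EFinD.
  exact: integrableD.
under eq_fun do rewrite Im_addc EFinD.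
exact: integrableD.
Qed.

Lemma cintD f g : cinteg f -> cinteg g -> cint (fun p => f p + g p) = cint f + cint g.
Proof.
move=> [rf imf] [rg ig]; apply: eq_ReIm; rewrite ?Re_addc ?Im_addc /=.
  by rewrite -RintegralD//; apply: eq_Rintegral => p _; rewrite Re_addc.
by rewrite -RintegralD//; apply: eq_Rintegral => p _; rewrite Im_addc.
Qed.

Lemma cintegZ z f : cinteg f -> cinteg (fun p => z * f p).
Proof.
move=> [rf imf]; split.
  under eq_fun do rewrite Re_mulc EFinB !EFinM.
  by apply: integrableB => //; exact: integrableZl.
under eq_fun do rewrite Im_mulc EFinD !EFinM.
by apply: integrableD => //; exact: integrableZl.
Qed.

Lemma cintZ z f : cinteg f -> cint (fun p => z * f p) = z * cint f.
Proof.
move=> [rf imf].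
have iZ (c : R) (h : P -> R) : mu.-integrable setT (fun p => (h p)%:E) ->
    mu.-integrable setT (EFin \o (fun p => c * h p)).
  by move=> ih; exact: (integrableZl measurableT c ih).
apply: eq_ReIm; rewrite ?Re_mulc ?Im_mulc /=.
  rewrite -!RintegralZl// -RintegralB//; [|exact: iZ|exact: iZ].
  by apply: eq_Rintegral => p _; rewrite Re_mulc.
rewrite -!RintegralZl// -RintegralD//; [|exact: iZ|exact: iZ].
by apply: eq_Rintegral => p _; rewrite Im_mulc.
Qed.

Lemma cintB f g : cinteg f -> cinteg g -> cint (fun p => f p - g p) = cint f - cint g.
Proof.
move=> iF ig; rewrite -(mulN1r (cint g)) -cintZ// -cintD//; last exact: cintegZ.
by congr cint; apply/funext => p; rewrite mulN1r.
Qed.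

Lemma cint0 : cint (fun _ => 0) = 0.
Proof. by apply: eq_ReIm; rewrite /= Rintegral_cst// mul0r. Qed.

Lemma cinteg0 : cinteg (fun _ => 0).
Proof. by split; exact: integrable0. Qed.

Lemma cint_sum (I : Type) (s : seq I) (c : I -> R[i]) (f : I -> P -> R[i]) :
  (forall i, cinteg (f i)) ->
  cinteg (fun p => \sum_(i <- s) c i * f i p) /\
  cint (fun p => \sum_(i <- s) c i * f i p) = \sum_(i <- s) c i * cint (f i).
Proof.
move=> iF; elim: s => [|i s [IH1 IH2]].
  under eq_fun do rewrite big_nil.
  by rewrite big_nil; split; [exact: cinteg0|exact: cint0].
under eq_fun do rewrite big_cons.
rewrite big_cons; split; first by apply: cintegD => //; exact: cintegZ.
by rewrite cintD ?IH2 ?cintZ//; exact: cintegZ.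
Qed.

Lemma cint_conj f : cinteg f -> (cint f)^* = cint (fun p => (f p)^*).
Proof.
move=> [rf imf]; apply: eq_ReIm; rewrite ?Re_conjc ?Im_conjc /=.
  by apply: eq_Rintegral => p _; rewrite Re_conjc.
rewrite -mulN1r -RintegralZl//.
by apply: eq_Rintegral => p _; rewrite Im_conjc mulN1r.
Qed.

Lemma integrable_ge0_lty h : measurable_fun setT h -> (forall p, 0 <= h p) ->
  (\int[mu]_p (h p)%:E < +oo)%E -> mu.-integrable setT (fun p => (h p)%:E).
Proof.
move=> mh h0 fin_h; apply/integrableP; split; first exact/measurable_EFinP.
by under eq_integral do rewrite gee0_abs ?lee_fin ?h0//.
Qed.

Lemma cinteg_L2 f g : cmeas f -> cmeas g ->
  (\int[mu]_p (normc (f p) ^+ 2)%:E < +oo)%E ->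
  (\int[mu]_p (normc (g p) ^+ 2)%:E < +oo)%E ->
  cinteg (fun p => f p * conjc (g p)).
Proof.
move=> mf mg f2 g2.
have i2 (h : P -> R[i]) : cmeas h -> (\int[mu]_p (normc (h p) ^+ 2)%:E < +oo)%E ->
    mu.-integrable setT (fun p => (normc (h p) ^+ 2)%:E).
  by move=> mh; apply: integrable_ge0_lty; [exact: measurable_normc2|move=> p; exact: sqr_ge0].
apply: (cinteg_dom (h := fun p => normc (f p) ^+ 2 + normc (g p) ^+ 2)).
- by apply: cmeasM => //; exact: cmeasJ.
- exact: (integrableD measurableT (i2 _ mf f2) (i2 _ mg g2)).
- move=> p; rewrite Normc.normcM normc_conj; move: (normc (f p)) (normc (g p)) => x y.
  have := sqr_ge0 (x - y); have := sqr_ge0 (x + y); rewrite sqrrB sqrrD; lra.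
Qed.

(** Since |z| <= |Re z| + |Im z| and exp(k |x|) <= exp(k x) + exp(- k x), four exponentials of
    linear forms dominate the integrand. *)
Lemma integrable_exp_normc f (c : R) : cmeas f ->
  (forall a b : R, \int[mu]_p (expR (a * Re (f p) + b * Im (f p)))%:E < +oo)%E ->
  mu.-integrable setT (fun p => (expR (c * normc (f p)))%:E).
Proof.
move=> [mre mim] fin_exp.
have iexp (a b : R) : mu.-integrable setT (fun p => (expR (a * Re (f p) + b * Im (f p)))%:E).
  apply: integrable_ge0_lty => //.
  by apply: measurableT_comp => //; apply: measurable_funD; apply: measurable_funM.
pose k := `|c|.
have isum := integrableD measurableT (integrableD measurableT (iexp k k) (iexp k (- k)))
  (integrableD measurableT (iexp (- k) k) (iexp (- k) (- k))).
apply: le_integrable isum => //.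
  apply/measurable_EFinP; apply: measurableT_comp => //; apply: measurable_funM => //.
  exact: measurable_normc.
move=> p _; rewrite -!EFinD !abse_EFin lee_fin (ger0_norm (expR_ge0 _)).
have E (x : R) : expR (k * `|x|) <= expR (k * x) + expR (- k * x).
  case: (ger0P x) => _; first by rewrite lerDl expR_ge0.
  by rewrite mulrN mulNr lerDr expR_ge0.
apply: le_trans (ler_norm _); rewrite !expRD.
apply: (@le_trans _ _ (expR (k * `|Re (f p)|) * expR (k * `|Im (f p)|))).
  rewrite -expRD ler_expR -mulrDr; apply: (@le_trans _ _ (k * normc (f p))).
    by rewrite ler_wpM2r ?normc_ge0// ler_norm.
  by apply: ler_wpM2l; [exact: normr_ge0|exact: normc_le_ReIm].
apply: le_trans (ler_pM (expR_ge0 _) (expR_ge0 _) (E (Re (f p))) (E (Im (f p)))) _.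
by rewrite mulrDl !mulrDr.
Qed.

Lemma exp_L2 f (w : R[i]) : cmeas f ->
  (forall c : R, mu.-integrable setT (fun p => (expR (c * normc (f p)))%:E)) ->
  (\int[mu]_p (normc (cexp (f p * w)) ^+ 2)%:E < +oo)%E.
Proof.
move=> mf int_exp; have iw := int_exp (2 * normc w).
have mk : cmeas (fun p => cexp (f p * w)).
  by apply: cmeas_exp; apply: cmeasM => //; exact: cmeas_cst.
have /integrableP[_] := iw; apply: le_lt_trans; apply: ge0_le_integral => //.
- by move=> p _; rewrite lee_fin sqr_ge0.
- by apply/measurable_EFinP; exact: measurable_normc2.
- by apply: measurableT_comp => //; exact: measurable_int iw.
- move=> p _; rewrite abse_EFin ger0_norm ?expR_ge0// lee_fin normc_cexp -expRM_natl ler_expR.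
  rewrite -mulrA ler_wpM2l//; apply: le_trans (ler_norm _) _.
  by apply: le_trans (normr_Re_le _) _; rewrite Normc.normcM mulrC.
Qed.

End complex_integral.

(** * Laplace integrals are uniform limits of polynomials on discs *)

Section exponential_kernel.
Context {R : realType} {d : measure_display} {P : measurableType d}.
Variables (mu : {measure set P -> \bar R}) (Z : P -> R[i]).
Local Notation normc := Normc.normc.
Local Notation Re := complex.Re.
Local Notation Im := complex.Im.
Hypothesis mZ : cmeas Z.
Hypothesis int_exp : forall c : R,
  mu.-integrable setT (fun p => (expR (c * normc (Z p)))%:E).

Let int_Cexp (C c : R) : mu.-integrable setT (fun p => (C * expR (c * normc (Z p)))%:E).
Proof. exact: (integrableZl measurableT C (int_exp c)). Qed.

(** The Taylor polynomials of the exponential are integrated term by term. For |x| <= r, [cexp_tail]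
    with L = 2 bounds the remainder by 2^-n exp(2 r |Z|), which is integrable against the majorant
    of m. *)
Lemma papprox_laplace (s m : P -> R[i]) (C c : R) : cmeas s -> cmeas m ->
  (forall p, normc (s p) <= normc (Z p)) ->
  (forall p, normc (m p) <= C * expR (c * normc (Z p))) ->
  papprox (fun x => cint mu (fun p => cexp (x * s p) * m p)).
Proof.
move=> ms mm sZ mC r e e0.
have C0 : 0 <= C.
  by have := le_trans (normc_ge0 _) (mC point); rewrite pmulr_lge0// expR_gt0.
pose I := \int[mu]_p (C * expR ((2 * r + c) * normc (Z p))).
have I0 : 0 <= I by apply: Rintegral_ge0 => p _; rewrite mulr_ge0 ?expR_ge0.
have [n nI] : exists n : nat, 2 * ((2^-1) ^+ n * I) <= e.
  have half : `|2^-1 : R| < 1 by rewrite ger0_norm//; lra.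
  have /cvgr0_norm_le := cvg_expr half.
  have eI : 0 < e / (2 * I + 1) by rewrite divr_gt0//; lra.
  move=> /(_ _ eI)[n _ /(_ n (leqnn n))]; rewrite ger0_norm ?exprn_ge0// => h.
  exists n; rewrite mulrCA mulrC.
  apply: (@le_trans _ _ ((2 * I) * (e / (2 * I + 1)))).
    by apply: ler_wpM2l => //; rewrite mulr_ge0.
  by rewrite mulrCA ler_piMr ?(ltW e0)// ler_pdivrMr//; lra.
(* The moments exist because |s|^k <= |Z|^k <= exp(k |Z|), as |Z| <= exp |Z|. *)
have ism k : cinteg mu (fun p => s p ^+ k * m p).
  apply: (cinteg_dom (h := fun p => C * expR ((k%:R + c) * normc (Z p)))).
  - by apply: cmeasM => //; exact: cmeasX.
  - exact: int_Cexp.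
  - move=> p; rewrite Normc.normcM normcX mulrDl expRD mulrCA ler_pM ?normc_ge0 ?exprn_ge0 ?normc_ge0//.
    apply: (@le_trans _ _ (expR (normc (Z p)) ^+ k)); last by rewrite -expRM_natl mulr_natl.
    apply: lerXn2r; rewrite ?nnegrE ?normc_ge0 ?expR_ge0//.
    by apply: le_trans (sZ p) _; have := expR_ge1Dx (normc (Z p)); lra.
pose a k := cint mu (fun p => s p ^+ k * m p).
exists (\poly_(k < n) (a k / k`!%:R)) => x xr.
have [iP cP] := @cint_sum _ _ _ mu _ (index_enum 'I_n) (fun k : 'I_n => x ^+ k / k`!%:R) _ (fun k => ism k).
have -> : (\poly_(k < n) (a k / k`!%:R)).[x] = cint mu (fun p => cexps n (x * s p) * m p).
  rewrite horner_poly.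
  transitivity (\sum_(k < n) x ^+ k / k`!%:R * a k); first by apply: eq_bigr => k _; ring.
  rewrite -cP; congr cint; apply/funext => p; rewrite /cexps mulr_suml.
  by apply: eq_bigr => k _; rewrite exprMn; ring.
have iP' : cinteg mu (fun p => cexps n (x * s p) * m p).
  move: iP; congr (cinteg mu _); apply/funext => p; rewrite /cexps mulr_suml.
  by apply: eq_bigr => k _; rewrite exprMn; ring.
have nxs p : normc (x * s p) <= r * normc (Z p).
  by rewrite Normc.normcM ler_pM ?normc_ge0.
have iE : cinteg mu (fun p => cexp (x * s p) * m p).
  apply: (cinteg_dom (h := fun p => C * expR ((r + c) * normc (Z p)))).
  - by apply: cmeasM => //; apply: cmeas_exp; apply: cmeasM => //; exact: cmeas_cst.
  - exact: int_Cexp.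
  - move=> p; rewrite Normc.normcM normc_cexp mulrDl expRD mulrCA ler_pM ?normc_ge0 ?expR_ge0//.
    rewrite ler_expR; apply: le_trans (ler_norm _) _; apply: le_trans (normr_Re_le _) _.
    exact: nxs.
rewrite -cintB//.
have bnd p : normc (cexp (x * s p) * m p - cexps n (x * s p) * m p) <=
    (2^-1) ^+ n * (C * expR ((2 * r + c) * normc (Z p))).
  rewrite -mulrBl Normc.normcM mulrDl expRD [leRHS](_ : _ =
    ((2^-1) ^+ n * expR (2 * r * normc (Z p))) * (C * expR (c * normc (Z p)))); last by ring.
  rewrite ler_pM ?normc_ge0//; apply: le_trans (cexp_tail n _ (ler1n _ 2)) _.
  by rewrite ler_wpM2l ?exprn_ge0// ler_expR -mulrA ler_wpM2l.
have ibnd : mu.-integrable setT (fun p => ((2^-1) ^+ n * (C * expR ((2 * r + c) * normc (Z p))))%:E).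
  exact: (integrableZl measurableT ((2^-1) ^+ n) (int_Cexp C (2 * r + c))).
apply: le_trans (normc_cint_le _ ibnd bnd) _; last first.
  by rewrite RintegralZl//; exact: int_Cexp.
have := cintegD iE (cintegZ (-1) iP'); congr (cinteg mu _).
by apply/funext => p; rewrite mulN1r.
Qed.

End exponential_kernel.

(** * The kernel K: holomorphy, decay on diagonals, vanishing *)

Section fourier_kernel.
Local Notation "x ^*" := (conjc x) : ring_scope.
Context {R : realType} {d : measure_display} {P : measurableType d}.
Variables (mu : {measure set P -> \bar R}) (Z : P -> R[i]).
Local Notation normc := Normc.normc.
Local Notation Re := complex.Re.
Local Notation Im := complex.Im.
Hypothesis mZ : cmeas Z.
Hypothesis int_exp : forall c : R,
  mu.-integrable setT (fun p => (expR (c * normc (Z p)))%:E).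
Hypothesis RL : forall f : P -> R, mu.-integrable setT (EFin \o f) ->
  forall e : R, 0 < e -> exists A : R, forall a b c : R, (A <= `|a|) || (A <= `|b|) ->
    `|\int[mu]_p (cos (a * Re (Z p) + b * Im (Z p) + c) * f p)| <= e.
Variables (F : P -> R[i]) (M : R).
Hypotheses (mF : cmeas F) (FM : forall p, normc (F p) <= M).
Implicit Types (x z w : R[i]).

Definition ker z w := cint mu (fun p => cexp (z * (Z p)^* - Z p * w^*) * F p).

Let conjM x z : (x * z)^* = x^* * z^*. Proof. exact: rmorphM. Qed.
Let conjD x z : (x + z)^* = x^* + z^*. Proof. exact: rmorphD. Qed.
Let conjB x z : (x - z)^* = x^* - z^*. Proof. exact: rmorphB. Qed.

Let M0 : 0 <= M. Proof. exact: le_trans (normc_ge0 _) (FM point). Qed.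

Let mE z w : cmeas (fun p => cexp (z * (Z p)^* - Z p * w^*) * F p).
Proof.
apply: cmeasM => //; apply: cmeas_exp; apply: cmeasD.
  by apply: cmeasM; [exact: cmeas_cst|exact: cmeasJ].
by apply: cmeasN; apply: cmeasM => //; exact: cmeas_cst.
Qed.

Let ker_dom z w p : normc (cexp (z * (Z p)^* - Z p * w^*) * F p) <=
  M * expR ((normc z + normc w) * normc (Z p)).
Proof.
rewrite Normc.normcM normc_cexp mulrC ler_pM ?normc_ge0 ?expR_ge0// ler_expR.
apply: le_trans (ler_norm _) _; apply: le_trans (normr_Re_le _) _.
apply: le_trans (le_normcD _ _) _; rewrite normcN !Normc.normcM !normc_conj.
by rewrite mulrDl (mulrC (normc (Z p)) (normc w)).
Qed.

Lemma cinteg_ker z w : cinteg mu (fun p => cexp (z * (Z p)^* - Z p * w^*) * F p).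
Proof.
apply: cinteg_dom (ker_dom z w) => //.
exact: (integrableZl measurableT M (int_exp _)).
Qed.

Lemma papprox_ker_left a b : papprox (fun x => ker (x + a) b).
Proof.
have -> : (fun x => ker (x + a) b) = (fun x => cint mu (fun p => cexp (x * (Z p)^*) *
    (cexp (a * (Z p)^* - Z p * b^*) * F p))).
  apply/funext => x; congr cint; apply/funext => p.
  by rewrite mulrA -cexpD mulrDl addrA.
apply: (papprox_laplace int_exp (cmeasJ mZ) (mE a b) _ (ker_dom a b)) => p.
by rewrite normc_conj.
Qed.

Lemma papprox_ker_right a b : papprox (fun x => (ker a (x + b))^*).
Proof.
have -> : (fun x => (ker a (x + b))^*) = (fun x => cint mu (fun p => cexp (x * (- (Z p)^*)) *
    (cexp (a * (Z p)^* - Z p * b^*) * F p)^*)).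
  apply/funext => x; rewrite /ker cint_conj; last exact: cinteg_ker.
  congr cint; apply/funext => p.
  rewrite !(conjM (cexp _)).
  rewrite -!cexp_conj mulrA -cexpD; congr (cexp _ * _).
  by rewrite !conjB !conjM conjD conjD !conjcK; ring.
apply: (papprox_laplace int_exp (C := M) (c := normc a + normc b)
  (cmeasN (cmeasJ mZ)) (cmeasJ (mE a b))) => p.
  by rewrite normcN normc_conj.
by rewrite normc_conj; exact: ker_dom.
Qed.

Let integrable_wave a b c (f : P -> R) : mu.-integrable setT (EFin \o f) ->
  mu.-integrable setT (EFin \o (fun p => cos (a * Re (Z p) + b * Im (Z p) + c) * f p)).
Proof.
move=> intf; apply: le_integrable (intf) => //.
  apply/measurable_EFinP; apply: measurable_funM.
    apply: measurableT_comp; first by apply: continuous_measurable_fun; exact: continuous_cos.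
    have [mR mI] := mZ.
    by apply: measurable_funD => //; apply: measurable_funD; apply: measurable_funM.
  by apply/measurable_EFinP; exact: measurable_int intf.
by move=> p _ /=; rewrite lee_fin normrM ler_piMl// ler_norml cos_geN1 cos_le1.
Qed.

(** A number minus its conjugate is imaginary; the translation x thus acts as a real frequency,
    namely 2 x rotated by a right angle. *)
Let unimodE x (Zp : R[i]) : x * Zp^* - Zp * x^* =
  0 +i* ((Im x *+ 2) * Re Zp + (- Re x *+ 2) * Im Zp).
Proof.
by case: x Zp => a b [c e]; apply: eq_ReIm; rewrite /=; ring.
Qed.

(** The sine is written as a cosine of phase - pi / 2, so that all four real integrals have the form
    covered by [RL]. *)
Let wave_cint (m : P -> R[i]) a b : cinteg mu m ->
  cint mu (fun p => cexp (0 +i* (a * Re (Z p) + b * Im (Z p))) * m p) =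
  ((\int[mu]_p (cos (a * Re (Z p) + b * Im (Z p) + 0) * Re (m p))) -
   (\int[mu]_p (cos (a * Re (Z p) + b * Im (Z p) + (- (pi / 2))) * Im (m p)))) +i*
  ((\int[mu]_p (cos (a * Re (Z p) + b * Im (Z p) + 0) * Im (m p))) +
   (\int[mu]_p (cos (a * Re (Z p) + b * Im (Z p) + (- (pi / 2))) * Re (m p)))).
Proof.
move=> [rm im]; apply: eq_ReIm => /=.
  rewrite -RintegralB//; [|exact: integrable_wave|exact: integrable_wave].
  apply: eq_Rintegral => p _; rewrite Re_mulc /= addr0 cosBpihalf expR0.
  by rewrite !mul1r.
rewrite -RintegralD//; [|exact: integrable_wave|exact: integrable_wave].
apply: eq_Rintegral => p _; rewrite Im_mulc /= addr0 cosBpihalf expR0.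
by rewrite !mul1r.
Qed.

Lemma ker_vanish a b (e : R) : 0 < e ->
  exists A : R, forall x, A <= normc x -> normc (ker (x + a) (x + b)) <= e.
Proof.
move=> e0; have e40 : 0 < e / 4 by rewrite divr_gt0.
pose m p := cexp (a * (Z p)^* - Z p * b^*) * F p.
have [rm im] : cinteg mu m by exact: cinteg_ker.
have [A1 H1] := RL rm e40; have [A2 H2] := RL im e40.
exists (Num.max A1 A2) => x; rewrite ge_max => /andP[x1 x2].
have -> : ker (x + a) (x + b) = cint mu (fun p =>
    cexp (0 +i* ((Im x *+ 2) * Re (Z p) + (- Re x *+ 2) * Im (Z p))) * m p).
  congr cint; apply/funext => p; rewrite /m mulrA -cexpD -unimodE; congr (cexp _ * _).
  by rewrite conjD; ring.
(* The larger of |Re x| and |Im x| is at least |x| / 2, and both frequencies carry a factor 2. *)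
have big (A : R) : A <= normc x -> (A <= `|Im x *+ 2|) || (A <= `|- Re x *+ 2|).
  move=> Ax; have := le_trans Ax (normc_le_ReIm x).
  rewrite -[Im x *+ 2]mulr_natr -[- Re x *+ 2]mulr_natr !normrM normrN (@ger0_norm _ 2)//.
  move=> h; have [h1|h1] := lerP `|Re x| `|Im x|; apply/orP; [left|right]; lra.
rewrite wave_cint; last by split.
apply: le_trans (normc_le_ReIm _) _ => /=.
have h1 := H1 _ _ 0 (big _ x1); have h2 := H2 _ _ (- (pi / 2)) (big _ x2).
have h3 := H2 _ _ 0 (big _ x2); have h4 := H1 _ _ (- (pi / 2)) (big _ x1).
apply: (@le_trans _ _ ((e / 4 + e / 4) + (e / 4 + e / 4))); last by lra.
apply: lerD.
  by apply: le_trans (ler_normB _ _) _; exact: lerD.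
by apply: le_trans (ler_normD _ _) _; exact: lerD.
Qed.

(** The vanishing integral expresses that F e_{-w} minus its image under the operator, here a finite
    sum, is orthogonal to e_z; the inner product of F e_{-w} with e_z is the kernel. *)
Lemma ker_sum N (c : 'I_N -> R[i]) (f : 'I_N -> P -> R[i]) z w :
  (forall j, cinteg mu (fun p => f j p * (cexp (Z p * z^*))^*)) ->
  cint mu (fun p => (F p * cexp (Z p * - w^*) - \sum_(j < N) c j * f j p) *
    (cexp (Z p * z^*))^*) = 0 ->
  ker z w = \sum_(j < N) c j * cint mu (fun p => f j p * (cexp (Z p * z^*))^*).
Proof.
move=> iF K0; have [iS cS] := cint_sum (index_enum 'I_N) c iF.
apply/eqP; rewrite -subr_eq0 -cS -cintB//; last exact: cinteg_ker.
apply/eqP; rewrite -[RHS]K0; congr cint; apply/funext => p.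
rewrite mulrBl mulr_suml; congr (_ - _).
  rewrite -cexp_conj conjM conjcK -[RHS]mulrA -cexpD mulrC.
  by congr (_ * cexp _); ring.
by apply: eq_bigr => j _; rewrite mulrA.
Qed.

(* x |-> det K(x+a_i, b_j) * conj det K(a_i, x+b_j) is entire, is |det K(a,b)|^2
   at 0 and, the kernel having rank r, equals det K(x+a_i, x+b_j) up to a
   constant in modulus, hence vanishes at infinity. *)
Lemma finite_rank_ker_eq0 N (A B : 'I_N -> R[i] -> R[i]) :
  (forall z w, ker z w = \sum_(j < N) A j z * B j w) -> forall z w, ker z w = 0.
Proof.
move=> kE; have [[|r] [a [b [ab maxr]]]] := max_minor kE.
  (* For r = 0 the vanishing minors of size 1 are the values of the kernel. *)
  move=> z w; have := maxr (fun _ => z) (fun _ => w).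
  by rewrite det_mx11 mxE.
exfalso; move/negP: (ab); apply.
pose sa x i := x + a i; pose sb x i := x + b i.
pose phi x := \det (kmx ker (sa x) b) * (\det (kmx ker a (sb x)))^*.
have phi0 : phi 0 = 0.
  apply: liouville0.
    apply: papproxM; first by apply: papprox_det => i j; exact: papprox_ker_left.
    have -> : (fun x => (\det (kmx ker a (sb x)))^*) =
       (fun x => \det (\matrix_(i, j) (ker (a i) (x + b j))^*)).
      apply/funext => x; rewrite -det_map_mx; congr (\det _).
      by apply/matrixP => i j; rewrite !mxE.
    by apply: papprox_det => i j; exact: papprox_ker_right.
  move=> e e0; pose D := normc (\det (kmx ker a b)).
  have D0 : 0 <= D by exact: normc_ge0.
  have c0 : 0 < (r.+1`!%:R * D + 1) by rewrite ltr_wpDl// mulr_ge0.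
  (* Entries must be at most 1 for [normc_det_le]; the other bound offsets the factorial and the
     constant minor [D]. *)
  pose e' := Num.min 1 (e / (r.+1`!%:R * D + 1)).
  have e'0 : 0 < e' by rewrite lt_min ltr01 divr_gt0.
  have /choice[rho Hrho] : forall ij : 'I_r.+1 * 'I_r.+1, exists A : R, forall x,
      A <= normc x -> normc (ker (x + a ij.1) (x + b ij.2)) <= e'.
    by move=> ij; exact: ker_vanish.
  (* A common radius beyond which all entries of the translated minor are small. *)
  exists (\sum_(ij : 'I_r.+1 * 'I_r.+1) `|rho ij|) => x xr.
  have -> : normc (phi x) = normc (\det (kmx ker (sa x) (sb x))) * D.
    by rewrite /phi Normc.normcM normc_conj -Normc.normcM -(det_minor_factor ab maxr) Normc.normcM.
  have : normc (\det (kmx ker (sa x) (sb x))) <= r.+1`!%:R * e'.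
    apply: normc_det_le; first by rewrite ge_min lexx.
    move=> i j; rewrite mxE; apply: (Hrho (i, j)); apply: le_trans xr.
    rewrite (bigD1 (i, j))//=; apply: le_trans (ler_norm _) _.
    by rewrite lerDl sumr_ge0.
  move=> /(ler_wpM2r D0) /le_trans; apply.
  rewrite mulrAC; apply: (@le_trans _ _ (r.+1`!%:R * D * (e / (r.+1`!%:R * D + 1)))).
    by apply: ler_wpM2l; [rewrite mulr_ge0|rewrite ge_min lexx orbT].
  by rewrite mulrCA ler_piMr ?(ltW e0)// ler_pdivrMr// mul1r lerDl.
move: phi0; rewrite /phi.
have -> : sa 0 = a by apply/funext => i; rewrite /sa add0r.
have -> : sb 0 = b by apply/funext => i; rewrite /sb add0r.
by move/eqP; rewrite mulf_eq0 conjc_eq0 orbb.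
Qed.

(** The diagonal of the kernel gives the Fourier transform of F, whose vanishing couples Re F and Im
    F. Comparing frequency (a, b) with (- a, - b) decouples them, as cosine integrals are even and
    sine integrals odd; the addition formula restores an arbitrary phase. *)
Lemma ker_eq0_fourier : (forall z w, ker z w = 0) -> forall a b c : R,
  \int[mu]_p (cos (a * Re (Z p) + b * Im (Z p) + c) * Re (F p)) = 0 /\
  \int[mu]_p (cos (a * Re (Z p) + b * Im (Z p) + c) * Im (F p)) = 0.
Proof.
move=> K0.
have iF : cinteg mu F.
  by have := cinteg_ker 0 0; congr (cinteg mu _); apply/funext => p;
     rewrite mul0r conjc0 mulr0 subrr cexp0 mul1r.
have [rF imF] := iF.
pose W a b c (h : P -> R) := \int[mu]_p (cos (a * Re (Z p) + b * Im (Z p) + c) * h p).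
have wave a b : W a b 0 (fun p => Re (F p)) = W a b (- (pi / 2)) (fun p => Im (F p)) /\
    W a b 0 (fun p => Im (F p)) = - W a b (- (pi / 2)) (fun p => Re (F p)).
  (* The diagonal point with frequency (a, b) in [unimodE]. *)
  have := K0 ((- b / 2) +i* (a / 2)) ((- b / 2) +i* (a / 2)).
  have -> : ker ((- b / 2) +i* (a / 2)) ((- b / 2) +i* (a / 2)) =
     cint mu (fun p => cexp (0 +i* (a * Re (Z p) + b * Im (Z p))) * F p).
    congr cint; apply/funext => p; rewrite unimodE /=; congr (cexp (0 +i* _) * _).
    by field.
  rewrite wave_cint// => -[h1 h2]; split; apply/eqP.
    by rewrite -subr_eq0; apply/eqP; exact: h1.
  by rewrite -addr_eq0; apply/eqP; exact: h2.
have even a b h : W (- a) (- b) 0 h = W a b 0 h.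
  by apply: eq_Rintegral => p _; rewrite -cosN; congr (cos _ * _); ring.
have odd a b h : mu.-integrable setT (fun p => (h p)%:E) ->
    W (- a) (- b) (- (pi / 2)) h = - W a b (- (pi / 2)) h.
  move=> ih; rewrite /W -[RHS]mulN1r -RintegralZl//; last exact: integrable_wave.
  apply: eq_Rintegral => p _; rewrite !cosBpihalf.
  rewrite (_ : - a * _ + _ = - (a * Re (Z p) + b * Im (Z p))); last by ring.
  by rewrite sinN; ring.
have zero a b : [/\ W a b 0 (fun p => Re (F p)) = 0, W a b 0 (fun p => Im (F p)) = 0,
    W a b (- (pi / 2)) (fun p => Re (F p)) = 0 & W a b (- (pi / 2)) (fun p => Im (F p)) = 0].
  have [h1 h2] := wave a b; have := wave (- a) (- b).
  by rewrite !even !odd// => -[h3 h4]; split; lra.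
have split_c a b c h : mu.-integrable setT (fun p => (h p)%:E) ->
    W a b c h = cos c * W a b 0 h - sin c * W a b (- (pi / 2)) h.
  move=> ih; rewrite /W -!RintegralZl//; [|exact: integrable_wave|exact: integrable_wave].
  have iZ (k : R) (g : P -> R) : mu.-integrable setT (EFin \o g) ->
      mu.-integrable setT (EFin \o (fun p => k * g p)).
    by move=> ig; exact: (integrableZl measurableT k ig).
  rewrite -RintegralB//; [|exact/iZ/integrable_wave|exact/iZ/integrable_wave].
  by apply: eq_Rintegral => p _; rewrite cosD cosBpihalf addr0; ring.
move=> a b c; have [z1 z2 z3 z4] := zero a b.
by split; rewrite -/(W _ _ _ _) split_c// ?z1 ?z2 ?z3 ?z4 !mulr0 subr0.
Qed.

End fourier_kernel.

(** * Toeplitz operators on the Fock space *)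

Section fock_kernels.
Context {R : realType}.
Local Notation P := (plane R).
Local Notation Z := (@complex_of_plane R).
Local Notation normc := Normc.normc.
Local Notation nuR := (@nu R).
Local Notation RR := (measurableTypeR R * measurableTypeR R)%type.

Lemma cmeasurableP (f : R[i] -> R[i]) :
  cmeasurable f <-> cmeas (fun p : P => f (Z p)).
Proof.
split=> [mf|[mre mim]].
  by split; [exact: (measurableT_comp measurable_fst mf)|exact: (measurableT_comp measurable_snd mf)].
exact: (measurable_fun_pair mre mim).
Qed.

Lemma cmeas_complex_of_plane : cmeas Z.
Proof.
split.
  exact: (@measurable_fun_plane _ _ (measurableTypeR R) (fst : RR -> measurableTypeR R)).
exact: (@measurable_fun_plane _ _ (measurableTypeR R) (snd : RR -> measurableTypeR R)).
Qed.

Lemma integrable_exp_nu (c : R) :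
  nuR.-integrable setT (fun p => (expR (c * normc (Z p)))%:E).
Proof.
apply: (integrable_exp_normc _ cmeas_complex_of_plane) => a b.
exact: integral_exp_nu_lty.
Qed.

Lemma fock_exp w : fock (fun z : R[i] => cexp (z * w)).
Proof.
split; last by move=> z; exact: cexp_derivable.
split; last exact: (exp_L2 w cmeas_complex_of_plane integrable_exp_nu).
apply/cmeasurableP; apply: cmeas_exp; apply: cmeasM; last exact: cmeas_cst.
exact: cmeas_complex_of_plane.
Qed.

Lemma cinteg_inner u v : fock u -> fock v ->
  cinteg nuR (fun p => u (Z p) * conjc (v (Z p))).
Proof.
move=> [[/cmeasurableP mu fu] _] [[/cmeasurableP mv fv] _].
exact: (cinteg_L2 mu mv fu fv).
Qed.

(* When no projection exists, [fock_proj v] is [v] itself, so that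
   orthogonality needs no completeness of the Fock space. *)
Lemma toeplitz_orth (F : R[i] -> R[i]) u g : fock g ->
  inner ((F \* u) \- toeplitz F u) g = 0.
Proof.
move=> fg; rewrite /toeplitz /fock_proj.
set S := [set _ | _]; have [exS|nS] := pselect (exists p, S p).
  by have [_] := xgetPex (F \* u) exS; exact.
rewrite xgetPN; last by move=> p Sp; apply: nS; exists p.
rewrite /inner (_ : (fun z => _) = fun _ => 0); first exact: (cint0 nuR).
by apply/funext => z; rewrite /= subrr mul0r.
Qed.

End fock_kernels.

Theorem corollary3p2 (R : realType) (F : R[i] -> R[i])
  (F_measurable : cmeasurable F)
  (F_bounded : exists M : R, forall z : R[i], `|F z| <= M%:C)
  (TF_finite_rank : finite_rank (toeplitz F)) :
  {ae @lambda R, forall p, F (complex_of_plane p) = 0}.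
Proof.
have [M FM'] := F_bounded.
have FM z : Normc.normc (F z) <= M by rewrite -lecR; exact: FM'.
have mF := (cmeasurableP F).1 F_measurable.
have [N [f [g [ff fg TF]]]] := TF_finite_rank.
pose Z := @complex_of_plane R.
have mZ := @cmeas_complex_of_plane R; have int_exp := @integrable_exp_nu R.
have FZ p : Normc.normc (F (Z p)) <= M by exact: FM.
pose k (w z : R[i]) := cexp (z * w).
(* Here e_z is [k (conjc z)], so the factors are A_j(z) = (f_j, e_z) and B_j(w) = (e_{-w}, g_j). *)
have KE z w : ker (@nu R) Z (F \o Z) z w =
    \sum_(j < N) inner (f j) (k (conjc z)) * inner (k (- conjc w)) (g j).
  under eq_bigr do rewrite mulrC.
  apply: (ker_sum mZ int_exp mF FZ (f := fun j p => f j (Z p))).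
    by move=> j; exact: (cinteg_inner (ff j) (fock_exp (conjc z))).
  have := toeplitz_orth F (k (- conjc w)) (fock_exp (conjc z)).
  by rewrite TF; last exact: fock_exp.
have K0 := finite_rank_ker_eq0 mZ int_exp (@riemann_lebesgue_plane R) mF FZ KE.
have fou := ker_eq0_fourier mZ int_exp mF FZ K0.
have re0 := @fourier_unique_plane R (fun p => complex.Re (F (Z p))) M mF.1
  (fun p => le_trans (normr_Re_le _) (FM (Z p))) (fun a b c => (fou a b c).1).
have im0 := @fourier_unique_plane R (fun p => complex.Im (F (Z p))) M mF.2
  (fun p => le_trans (normr_Im_le _) (FM (Z p))) (fun a b c => (fou a b c).2).
by apply: filterS2 re0 im0 => p r0 i0; exact: eq_ReIm.
Qed.
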